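(* Let $\mathbf{v}_1,\ldots,\mathbf{v}_k\in\mathbb{R}^k$ and $F:\mathbb{R}^{kn}\to\mathbb{R}$, \[ F(\mathbf{w}_1,\ldots,\mathbf{w}_n)=\mathbb{E}_{\mathbf{x}\sim\mathcal{N}(\mathbf{0},I_k)}\left[\frac{1}{2}\left(\sum_{i=1}^{n}[\mathbf{w}_i^\top\mathbf{x}]_+-\sum_{j=1}^{k}[\mathbf{v}_j^\top\mathbf{x}]_+\right)^2\right]. \] Let $(\mathbf{w}_1,\ldots,\mathbf{w}_n)$ be a point with all $\mathbf{w}_i$ and all $\mathbf{v}_j$ nonzero, $\theta_{\mathbf{w}_i,\mathbf{w}_j}\in(0,\pi)$ for $i\ne j$, and $\theta_{\mathbf{w}_i,\mathbf{v}_j}\in(0,\pi)$ for all $i,j$. Then the Hessian of $F$ at this point, written in $k\times k$ blocks, has diagonal blocks \[ \frac{\partial^2F}{\partial\mathbf{w}_i^2}=\frac{1}{2}I+\sum_{j\ne i}h_1(\mathbf{w}_i,\mathbf{w}_j)-\sum_{j=1}^k h_1(\mathbf{w}_i,\mathbf{v}_j), \] and off-diagonal blocks $\frac{\partial^2F}{\partial\mathbf{w}_i\partial\mathbf{w}_j}=h_2(\mathbf{w}_i,\mathbf{w}_j)$ for $i\ne j$, where \[ h_1(\mathbf{w},\mathbf{v})=\frac{\sin(\theta_{\mathbf{w},\mathbf{v}})\|\mathbf{v}\|}{2\pi\|\mathbf{w}\|}\left(I-\bar{\mathbf{w}}\bar{\mathbf{w}}^\top+\bar{\mathbf{n}}_{\mathbf{v},\mathbf{w}}\bar{\mathbf{n}}_{\mathbf{v},\mathbf{w}}^\top\right),\qquad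 h_2(\mathbf{w},\mathbf{v})=\frac{1}{2\pi}\left((\pi-\theta_{\mathbf{w},\mathbf{v}})I+\bar{\mathbf{n}}_{\mathbf{w},\mathbf{v}}\bar{\mathbf{v}}^\top+\bar{\mathbf{n}}_{\mathbf{v},\mathbf{w}}\bar{\mathbf{w}}^\top\right). \]
   Context: $[z]_+=\max\{0,z\}$; norms are Euclidean. For a nonzero vector $\mathbf{w}$, $\bar{\mathbf{w}}=\mathbf{w}/\|\mathbf{w}\|$. For nonzero $\mathbf{w},\mathbf{v}$, $\theta_{\mathbf{w},\mathbf{v}}=\arccos\left(\frac{\mathbf{w}^\top\mathbf{v}}{\|\mathbf{w}\|\|\mathbf{v}\|}\right)$, and when $\theta_{\mathbf{w},\mathbf{v}}\in(0,\pi)$, $\mathbf{n}_{\mathbf{v},\mathbf{w}}=\bar{\mathbf{v}}-\cos(\theta_{\mathbf{v},\mathbf{w}})\bar{\mathbf{w}}$ and $\bar{\mathbf{n}}_{\mathbf{v},\mathbf{w}}=\mathbf{n}_{\mathbf{v},\mathbf{w}}/\|\mathbf{n}_{\mathbf{v},\mathbf{w}}\|$. *)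

(* Defs.v *)
From HB Require Import structures.
From mathcomp Require Import all_boot all_order all_algebra.
From mathcomp Require Import all_classical all_reals all_analysis.
Set Implicit Arguments. Unset Strict Implicit. Unset Printing Implicit Defensive.
Import Order.TTheory GRing.Theory Num.Theory.
Import numFieldNormedType.Exports.
Local Open Scope ring_scope.

Section Defs.
Variable R : realType.

Definition gauss_pdf (t : R) : R := expR (- (t ^+ 2) / 2) / Num.sqrt (2 * pi).

(* E_{x ~ N(0, I_k)} [f x] for a nonnegative (extended-real valued) integrand,
   defined as the iterated integral over the k coordinates against the
   product Gaussian density (equal to the integral against N(0,I_k) by Tonelli). *)
Fixpoint gauss_exp (k : nat) : ('rV[R]_k -> \bar R) -> \bar R :=
  match k with
  | 0 => fun f => f 0
  | k'.+1 => fun f : 'rV[R]_k'.+1 -> \bar R =>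
      (\int[@lebesgue_measure R]_(t in setT)
         ((gauss_pdf t)%:E * gauss_exp
            (fun y : 'rV[R]_k' => f (row_mx (\row_(_ < 1) (t : R)) y : 'rV[R]_(1 + k')))))%E
  end.

Definition dotv (k : nat) (u v : 'rV[R]_k) : R := \sum_(a < k) u 0 a * v 0 a.
Definition normv (k : nat) (u : 'rV[R]_k) : R := Num.sqrt (dotv u u).
Definition relu (z : R) : R := Num.max 0 z.
Definition unitv (k : nat) (w : 'rV[R]_k) : 'rV[R]_k := (normv w)^-1 *: w.
Definition angle (k : nat) (w v : 'rV[R]_k) : R :=
  acos (dotv w v / (normv w * normv v)).
Definition nvec (k : nat) (v w : 'rV[R]_k) : 'rV[R]_k :=
  unitv v - cos (angle v w) *: unitv w.
Definition nbar (k : nat) (v w : 'rV[R]_k) : 'rV[R]_k := unitv (nvec v w).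

Definition outer (k : nat) (u v : 'rV[R]_k) : 'M[R]_k := u^T *m v.

Definition h1 (k : nat) (w v : 'rV[R]_k) : 'M[R]_k :=
  (sin (angle w v) * normv v / (2 * pi * normv w)) *:
    (1%:M - outer (unitv w) (unitv w) + outer (nbar v w) (nbar v w)).

Definition h2 (k : nat) (w v : 'rV[R]_k) : 'M[R]_k :=
  (2 * pi)^-1 *:
    ((pi - angle w v)%:M + outer (nbar w v) (unitv v) + outer (nbar v w) (unitv w)).

Definition Fobj (n k : nat) (V : 'M[R]_(k, k)) (W : 'M[R]_(n, k)) : R :=
  fine (gauss_exp (fun x : 'rV[R]_k =>
    (2^-1 * (\sum_(i < n) relu (dotv (row i W) x)
              - \sum_(j < k) relu (dotv (row j V) x)) ^+ 2)%:E)).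

End Defs.

(* Main.v *)
(** Expanding the square, the objective is a combination of the correlations
    [E (relu (w.x) * relu (v.x))].  The standard Gaussian measure of the plane is
    invariant under rotations (products of three shears, each handled by Tonelli
    and translation invariance), so two linear forms of a Gaussian vector can be
    replaced, one coordinate at a time, by [p X] and [q X + r Y] with the same Gram
    matrix.  Substituting [Y = X t] then gives the closed form
    [(sqrt (A C - B^2) + (pi - theta) B) / (2 pi)] in terms of [A = w.w], [B = w.v],
    [C = v.v].  Its partial derivatives are [sqrt (A C - B^2) / (4 pi A)] in [A] and
    [(pi - theta) / (2 pi)] in [B]; differentiating once more yields [h1] and [h2]. *)

Require Import Defs.
From HB Require Import structures.
From mathcomp Require Import all_boot all_order all_algebra.
From mathcomp Require Import ring lra.
From mathcomp Require Import all_classical all_reals all_analysis measurable_realfun.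
Import Order.TTheory GRing.Theory Num.Theory.
Import numFieldNormedType.Exports.
Set Implicit Arguments. Unset Strict Implicit. Unset Printing Implicit Defensive.
Local Open Scope classical_set_scope.
Local Open Scope ring_scope.

(** Two obstacles shape the proof. First, [gauss_exp] is an iterated integral of extended-real
    functions, with no product measure on vectors: additivity has to be obtained one coordinate at a
    time, and only for nonnegative measurable integrands. Hence the tailored notion of
    measurability, the expansion of the square without subtraction, and a separate proof that every
    correlation is finite, also for parallel vectors, where the closed form is not established.
    Second, the closed form is proved only where the Gram determinant is positive, while the Hessian
    differentiates a derivative, so the gradient formula must hold at all points near [W]. The angle
    conditions are therefore turned into positivity of Gram determinants, which is visibly an open
    condition. The pair made of a row of [W] with itself is always degenerate; its correlation w.w /
    2 is computed apart and produces the block I / 2. In the gradient, the derivative of [acos]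
    cancels against part of the derivative of the square root, which is why the first partial
    derivatives are so simple. *)

Section GaussianExpectation.

(** * Gaussian integrals on the line and rotation invariance in the plane *)

Context {R : realType}.
Local Notation mu := (@lebesgue_measure R).
Implicit Types (a b c s t : R) (f : R -> \bar R).

(** Pushing c times Lebesgue measure forward along x -> c x + a gives Lebesgue measure again: by
    uniqueness this needs checking on half-open intervals only. *)
Lemma ge0_integral_affine c a f : 0 < c -> measurable_fun setT f ->
  (forall x, 0 <= f x)%E ->
  (\int[mu]_x f x = c%:E * \int[mu]_x f (c * x + a)%R)%E.
Proof.
move=> c0 mf f0; pose h x : measurableTypeR R := c * x + a.
have mh : measurable_fun setT h.
  by apply: measurable_funD => //; exact: measurable_funM.
have c0' : 0 <= c by exact: ltW.
transitivity (\int[pushforward (mscale (NngNum c0') mu) h]_x f x)%E; last first.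
  rewrite ge0_integral_pushforward// preimage_setT ge0_integral_mscale//.
  - exact: measurableT_comp.
  - by move=> x _; exact: f0.
apply: eq_measure_integral => // A mA _.
apply: lebesgue_measure_unique => //.
move=> _ [[u v] _ <-] /=.
rewrite /pushforward /mscale /=.
have -> : h @^-1` `]u, v] = `](u - a) / c, (v - a) / c]%classic.
  apply/seteqP; split => x /=; rewrite !in_itv/= /h.
    by rewrite ltr_pdivrMr// ler_pdivlMr// mulrC ltrBlDr lerBrDr.
  by rewrite ltr_pdivrMr// ler_pdivlMr// mulrC ltrBlDr lerBrDr.
rewrite !lebesgue_measure_itv/= !lte_fin ltr_pM2r ?invr_gt0// ltrD2r.
case: ifP => _; last by rewrite mule0.
by rewrite -!EFinB -EFinM; congr EFin; field; rewrite gt_eqF.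
Qed.

Definition gauss1 f : \bar R := (\int[mu]_x ((gauss_pdf x)%:E * f x))%E.

Lemma gauss_pdf_ge0 t : 0 <= gauss_pdf t.
Proof. by rewrite /gauss_pdf divr_ge0 ?expR_ge0 ?sqrtr_ge0. Qed.

Lemma measurable_gauss_pdf : measurable_fun setT (@gauss_pdf R).
Proof.
apply: measurable_funM => //; apply: measurableT_comp => //.
apply: measurable_funM => //; apply: measurableT_comp => //.
Qed.

Lemma gauss_pdf_normal : @gauss_pdf R = normal_pdf 0 1.
Proof.
apply/funext => x; rewrite normal_pdfE ?oner_neq0// /gauss_pdf mulrC.
rewrite /normal_peak /normal_fun subr0 expr1n !mulr_natl.
by rewrite mul1r.
Qed.

(** The joint density is radial, which is what rotation invariance rests on. *)
Lemma gauss_pdf_mulE a b :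
  gauss_pdf a * gauss_pdf b = expR (- (a ^+ 2 + b ^+ 2) / 2) / (2 * pi).
Proof.
rewrite /gauss_pdf mulrACA -expRD -invfM -expr2 sqr_sqrtr; last first.
  by rewrite mulr_ge0// pi_ge0.
by congr (expR _ / _); lra.
Qed.

Lemma gauss1_ge0 f : (forall x, 0 <= f x)%E -> (0 <= gauss1 f)%E.
Proof.
by move=> f0; apply: integral_ge0 => x _; rewrite mule_ge0// lee_fin gauss_pdf_ge0.
Qed.

(** The density has mass 1. This is the device for inserting or integrating out a dummy coordinate;
    the value +oo is allowed. *)
Lemma gauss1_cst (c : \bar R) : (0 <= c)%E -> gauss1 (fun=> c) = c.
Proof.
move=> c0; rewrite /gauss1 ge0_integralZr//.
- by rewrite gauss_pdf_normal integral_normal_pdf mul1e.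
- by apply/measurable_EFinP; exact: measurable_gauss_pdf.
- by move=> x _; rewrite lee_fin gauss_pdf_ge0.
Qed.

Lemma measurable_gauss_pdfM d (T : measurableType d) (h : T -> R) (g : T -> \bar R) :
  measurable_fun setT h -> measurable_fun setT g ->
  measurable_fun setT (fun x => (gauss_pdf (h x))%:E * g x)%E.
Proof.
move=> mh mg; apply: emeasurable_funM => //.
apply/measurable_EFinP; apply: measurableT_comp => //; exact: measurable_gauss_pdf.
Qed.

Lemma gauss1D f (g : R -> \bar R) :
  measurable_fun setT f -> measurable_fun setT g ->
  (forall x, 0 <= f x)%E -> (forall x, 0 <= g x)%E ->
  gauss1 (fun x => f x + g x)%E = (gauss1 f + gauss1 g)%E.
Proof.
move=> mf mg f0 g0; rewrite /gauss1 -ge0_integralD//.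
- by apply: eq_integral => x _; rewrite ge0_muleDr.
- by move=> x _; rewrite mule_ge0// lee_fin gauss_pdf_ge0.
- exact: measurable_gauss_pdfM.
- by move=> x _; rewrite mule_ge0// lee_fin gauss_pdf_ge0.
- exact: measurable_gauss_pdfM.
Qed.

Lemma gauss1Z (c : R) f : measurable_fun setT f -> (forall x, 0 <= f x)%E ->
  (0 <= c)%R -> gauss1 (fun x => c%:E * f x)%E = (c%:E * gauss1 f)%E.
Proof.
move=> mf f0 c0; rewrite /gauss1 -ge0_integralZl//.
- by apply: eq_integral => x _; rewrite muleCA.
- exact: measurable_gauss_pdfM.
- by move=> x _; rewrite mule_ge0// lee_fin gauss_pdf_ge0.
Qed.

Lemma measurable_gauss1 d (T : measurableType d) (g : T * R -> \bar R) :
  measurable_fun setT g -> (forall z, 0 <= g z)%E ->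
  measurable_fun setT (fun t : T => gauss1 (fun x => g (t, x))).
Proof.
move=> mg g0.
apply: (measurable_fun_fubini_tonelli_F (m2 := mu)
  (fun z : T * R => (gauss_pdf z.2)%:E * g z)%E).
  exact: measurable_gauss_pdfM.
by move=> z; rewrite mule_ge0// lee_fin gauss_pdf_ge0.
Qed.

Definition int2 (G : R * R -> \bar R) : \bar R := (\int[mu]_x \int[mu]_y G (x, y))%E.

Definition gauss2 (g : R * R -> \bar R) : \bar R :=
  gauss1 (fun x => gauss1 (fun y => g (x, y))).

(** Gathers both weights in one integrand on the plane, so that the invariances of [int2] apply. *)
Lemma gauss2E (g : R * R -> \bar R) :
  measurable_fun setT g -> (forall z, 0 <= g z)%E ->
  gauss2 g = int2 (fun z => (gauss_pdf z.1 * gauss_pdf z.2)%:E * g z)%E.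
Proof.
move=> mg g0; apply: eq_integral => x _; rewrite /gauss1 -ge0_integralZl//.
- by apply: eq_integral => y _; rewrite muleA.
- apply: measurable_gauss_pdfM => //; exact: measurableT_comp.
- by move=> y _; rewrite mule_ge0// lee_fin gauss_pdf_ge0.
- by rewrite lee_fin gauss_pdf_ge0.
Qed.

Lemma measurable_linear2 a b : measurable_fun setT (fun z : R * R => a * z.1 + b * z.2).
Proof. by apply: measurable_funD; exact: measurable_funM. Qed.

Definition lin2 a b a' b' (z : R * R) : R * R :=
  (a * z.1 + b * z.2, a' * z.1 + b' * z.2).

Lemma comp_lin2 (G : R * R -> \bar R) a b a' b' c d c' d' :
  (G \o lin2 a b a' b') \o lin2 c d c' d' =
  G \o lin2 (a * c + b * c') (a * d + b * d') (a' * c + b' * c') (a' * d + b' * d').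
Proof. by apply/funext => -[x y]; rewrite /lin2 /=; congr (G (_, _)); ring. Qed.

Lemma measurable_lin2 a b a' b' : measurable_fun setT (lin2 a b a' b').
Proof. by apply/measurable_fun_pair; exact: measurable_linear2. Qed.

Lemma measurable_comp_lin2 a b a' b' (G : R * R -> \bar R) :
  measurable_fun setT G -> measurable_fun setT (G \o lin2 a b a' b').
Proof. by move=> mG; apply: measurableT_comp => //; exact: measurable_lin2. Qed.

Lemma int2_shear2 a (G : R * R -> \bar R) :
  measurable_fun setT G -> (forall z, 0 <= G z)%E ->
  int2 G = int2 (G \o lin2 1 0 a 1).
Proof.
move=> mG G0; apply: eq_integral => x _.
rewrite (@ge0_integral_affine 1 (a * x))//; last exact: measurableT_comp.
rewrite mul1e; apply: eq_integral => y _ /=; rewrite /lin2 /=.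
by congr (G (_, _)); ring.
Qed.

Lemma int2_swap (G : R * R -> \bar R) :
  measurable_fun setT G -> (forall z, 0 <= G z)%E ->
  int2 G = int2 (G \o lin2 0 1 1 0).
Proof.
move=> mG G0; rewrite /int2; etransitivity; first exact: fubini_tonelli.
apply: eq_integral => x _; apply: eq_integral => y _ /=; rewrite /lin2 /=.
by congr (G (_, _)); ring.
Qed.

(** This is the other shear conjugated by the swap of coordinates. *)
Lemma int2_shear1 a (G : R * R -> \bar R) :
  measurable_fun setT G -> (forall z, 0 <= G z)%E ->
  int2 G = int2 (G \o lin2 1 a 0 1).
Proof.
move=> mG G0.
have mG1 := measurable_comp_lin2 0 1 1 0 mG.
have mG2 := measurable_comp_lin2 1 0 a 1 mG1.
rewrite (int2_swap mG G0) (int2_shear2 a mG1); last by move=> z; exact: G0.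
rewrite (int2_swap mG2); last by move=> z; exact: G0.
rewrite !comp_lin2.
by congr (int2 (_ \o _)); congr lin2; ring.
Qed.

(* A rotation by an angle that is not a multiple of [pi] is a product of three shears. *)
Lemma int2_rotation c s (G : R * R -> \bar R) :
  c ^+ 2 + s ^+ 2 = 1 -> s != 0 ->
  measurable_fun setT G -> (forall z, 0 <= G z)%E ->
  int2 G = int2 (G \o lin2 c (- s) s c).
Proof.
(* For c = cos t and s = sin t this is - tan (t / 2), the slope of the two outer shears. *)
move=> cs s0 mG G0; pose a := (c - 1) / s.
have asE : a * s = c - 1 by rewrite /a divfK.
have mG1 := measurable_comp_lin2 1 a 0 1 mG.
have mG2 := measurable_comp_lin2 1 0 s 1 mG1.
rewrite (int2_shear1 a mG G0) (int2_shear2 s mG1); last by move=> z; exact: G0.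
rewrite (int2_shear1 a mG2); last by move=> z; exact: G0.
rewrite !comp_lin2; congr (int2 (_ \o _)); congr lin2.
- by transitivity (1 + a * s); [ring|rewrite asE; ring].
- transitivity (a * (2 + a * s)); first ring.
  by apply: (mulIf s0); rewrite mulrAC asE; lra.
- ring.
- by transitivity (1 + a * s); [ring|rewrite asE; ring].
Qed.

Lemma gauss2_rotation_neq0 c s (g : R * R -> \bar R) :
  c ^+ 2 + s ^+ 2 = 1 -> s != 0 ->
  measurable_fun setT g -> (forall z, 0 <= g z)%E ->
  gauss2 g = gauss2 (g \o lin2 c (- s) s c).
Proof.
move=> cs s0 mg g0.
have mg1 := measurable_comp_lin2 c (- s) s c mg.
rewrite (gauss2E mg g0) (gauss2E mg1); last by move=> z; exact: g0.
rewrite (int2_rotation cs s0).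
- congr int2; apply/funext => -[x y] /=; congr (_%:E * _)%E.
  rewrite (gauss_pdf_mulE x y) gauss_pdf_mulE.
  have -> : (c * x + - s * y) ^+ 2 + (s * x + c * y) ^+ 2 =
    (c ^+ 2 + s ^+ 2) * (x ^+ 2 + y ^+ 2) by ring.
  by rewrite cs mul1r.
- apply: emeasurable_funM => //; apply/measurable_EFinP/measurable_funM.
    by apply: measurableT_comp => //; exact: measurable_gauss_pdf.
  by apply: measurableT_comp => //; exact: measurable_gauss_pdf.
- by move=> z; rewrite mule_ge0// lee_fin mulr_ge0// gauss_pdf_ge0.
Qed.

Lemma gauss2_rotation c s (g : R * R -> \bar R) :
  c ^+ 2 + s ^+ 2 = 1 ->
  measurable_fun setT g -> (forall z, 0 <= g z)%E ->
  gauss2 g = gauss2 (g \o lin2 c (- s) s c).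
Proof.
move=> cs mg g0; have [s0|s0] := eqVneq s 0; last exact: gauss2_rotation_neq0.
move: cs; rewrite s0 expr0n/= addr0 => /eqP; rewrite sqrf_eq1 => /orP[]/eqP->.
  by congr gauss2; apply/funext => -[x y]; rewrite /lin2 /=; congr (g (_, _)); ring.
(* Case c = -1: the half turn is the square of the quarter turn, whose sine is nonzero. *)
have one : 0 ^+ 2 + 1 ^+ 2 = 1 :> R by ring.
have mg1 := measurable_comp_lin2 0 (- 1) 1 0 mg.
rewrite (gauss2_rotation_neq0 one (oner_neq0 R) mg g0).
rewrite (gauss2_rotation_neq0 one (oner_neq0 R) mg1); last by move=> z; exact: g0.
by rewrite comp_lin2; congr (gauss2 (_ \o _)); congr lin2; ring.
Qed.

Lemma polar_decomposition a b : exists c s p,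
  [/\ c ^+ 2 + s ^+ 2 = 1, a = p * c & b = p * s].
Proof.
have [ab0|ab0] := eqVneq (a ^+ 2 + b ^+ 2) 0.
  move: ab0 => /eqP; rewrite paddr_eq0 ?sqr_ge0// !sqrf_eq0 => /andP[/eqP-> /eqP->].
  by exists 1, 0, 0; rewrite !mul0r; split => //; ring.
have p0 : 0 < a ^+ 2 + b ^+ 2 by rewrite lt0r ab0 addr_ge0// sqr_ge0.
pose p := Num.sqrt (a ^+ 2 + b ^+ 2).
have pp : p ^+ 2 = a ^+ 2 + b ^+ 2 by rewrite sqr_sqrtr// ltW.
have pn0 : p != 0 by rewrite gt_eqF// sqrtr_gt0.
exists (a / p), (b / p), p; split.
- by rewrite !exprMn -mulrDl exprVn -pp divff// expf_neq0.
- by rewrite mulrC divfK.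
- by rewrite mulrC divfK.
Qed.

(** The rotation that takes (a, b) to the first axis makes the form depend on one coordinate; the
    other one integrates out. *)
Lemma gauss2_merge a b : exists2 r, r ^+ 2 = a ^+ 2 + b ^+ 2 &
  forall f, measurable_fun setT f -> (forall x, 0 <= f x)%E ->
  gauss2 (fun z => f (a * z.1 + b * z.2)) = gauss1 (fun x => f (r * x)).
Proof.
have [c [s [p [cs -> ->]]]] := polar_decomposition a b.
exists p; first by rewrite !exprMn -mulrDr cs mulr1.
move=> f mf f0.
have ml := measurable_linear2 (p * c) (p * s).
rewrite (gauss2_rotation cs)//; last exact: (measurableT_comp mf ml).
rewrite /gauss2; congr gauss1; apply/funext => x; rewrite -[RHS]gauss1_cst//.
congr gauss1; apply/funext => y; rewrite /lin2 /=; congr f.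
transitivity (p * ((c ^+ 2 + s ^+ 2) * x)); first ring.
by rewrite cs mul1r.
Qed.

(* Adding one Gaussian coordinate updates the Cholesky factor [p, q, r] of the
   Gram matrix of two linear forms. *)
Lemma gauss3_merge (w v p q r : R) : exists p' q' r',
  [/\ p' ^+ 2 = w ^+ 2 + p ^+ 2, p' * q' = w * v + p * q,
      q' ^+ 2 + r' ^+ 2 = v ^+ 2 + (q ^+ 2 + r ^+ 2) &
   forall g : R * R -> \bar R, measurable_fun setT g -> (forall z, 0 <= g z)%E ->
   gauss1 (fun t => gauss2 (fun z => g (w * t + p * z.1, v * t + (q * z.1 + r * z.2)))) =
   gauss2 (fun z => g (p' * z.1, q' * z.1 + r' * z.2))].
Proof.
have [c [s [p' [cs wE pE]]]] := polar_decomposition w p.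
(* Rotating the plane of t and z.1 turns the first form into p' t and the second into q' t + m x + r
   y; the tail m x + r y is then merged into a single term with coefficient r'. *)
pose q' := v * c + q * s; pose m := q * c - v * s.
have [r' r'E r'P] := gauss2_merge m r.
exists p', q', r'; split.
- by rewrite wE pE !exprMn -mulrDr cs mulr1.
- by rewrite wE pE /q'; ring.
- rewrite r'E /q' /m.
  transitivity ((c ^+ 2 + s ^+ 2) * (v ^+ 2 + q ^+ 2) + r ^+ 2); first ring.
  by rewrite cs; ring.
move=> g mg g0.
pose h (z : R * R) := gauss1 (fun y => g (w * z.1 + p * z.2, v * z.1 + (q * z.2 + r * y))).
have mh : measurable_fun setT h.
  apply: (measurable_gauss1 (g := fun u : (R * R) * R => g (w * u.1.1 + p * u.1.2,
    v * u.1.1 + (q * u.1.2 + r * u.2)))) => //.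
  apply: measurableT_comp => //; apply/measurable_fun_pair => /=.
    by apply: measurable_funD; apply: measurable_funM => //; exact: measurableT_comp.
  apply: measurable_funD; last apply: measurable_funD; apply: measurable_funM => //; exact: measurableT_comp.
rewrite -[LHS]/(gauss2 h) (gauss2_rotation cs mh); last by move=> z; exact: gauss1_ge0.
rewrite /gauss2; congr gauss1; apply/funext => t.
have mu' : measurable_fun setT (fun u : R => g (p' * t, q' * t + u)).
  apply: measurableT_comp => //; apply/measurable_fun_pair => //=.
  exact: measurable_funD.
rewrite -[RHS](r'P _ mu' (fun u => g0 _)).
rewrite /gauss2 /h; congr gauss1; apply/funext => x; congr gauss1; apply/funext => y.
rewrite /lin2 /= wE pE; congr (g (_, _)).
  by transitivity (p' * ((c ^+ 2 + s ^+ 2) * t)); [ring|rewrite cs mul1r].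
by rewrite /q' /m; ring.
Qed.

End GaussianExpectation.

(** * Iterated Gaussian expectations over vectors *)

Section MultivariateGaussianExpectation.
Context {R : realType}.
Local Notation mu := (@lebesgue_measure R).

(* ['rV_k] carries no sigma-algebra: measurability is tested along measurable
   families of coordinates. *)
Definition kmeasurable (k : nat) d (T : measurableType d) (f : T -> 'rV[R]_k -> \bar R) :=
  forall d' (T' : measurableType d') (h : T' -> T) (c : 'I_k -> T' -> R),
    measurable_fun setT h -> (forall i, measurable_fun setT (c i)) ->
    measurable_fun setT (fun t => f (h t) (\row_i c i t)).

Definition consv (k : nat) (t : R) (y : 'rV[R]_k) : 'rV[R]_k.+1 :=
  row_mx (\row_(_ < 1) t) y : 'rV[R]_(1 + k).

Lemma gauss_expS k (f : 'rV[R]_k.+1 -> \bar R) :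
  gauss_exp f = gauss1 (fun t => gauss_exp (fun y => f (consv t y))).
Proof. by []. Qed.

Lemma consv0 k t (y : 'rV[R]_k) : consv t y 0 ord0 = t.
Proof.
rewrite /consv (_ : ord0 = lshift k (ord0 : 'I_1)); last exact: val_inj.
by rewrite (row_mxEl (\row_(_ < 1) t)) mxE.
Qed.

Lemma consvS k t (y : 'rV[R]_k) i : consv t y 0 (lift ord0 i) = y 0 i.
Proof.
rewrite /consv (_ : lift ord0 i = rshift 1 i); last exact: val_inj.
by rewrite (row_mxEr (\row_(_ < 1) t)).
Qed.

Lemma consv_row k (c : 'I_k.+1 -> R) :
  consv (c ord0) (\row_i c (lift ord0 i)) = \row_i c i.
Proof.
apply/rowP => i; rewrite [RHS]mxE; case: (unliftP ord0 i) => [j ->|->].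
  by rewrite consvS mxE.
by rewrite consv0.
Qed.

Lemma gauss_exp_ge0 k (f : 'rV[R]_k -> \bar R) :
  (forall x, 0 <= f x)%E -> (0 <= gauss_exp f)%E.
Proof.
elim: k f => [|k IH] f f0; first exact: f0.
by rewrite gauss_expS; apply: gauss1_ge0 => t; exact: IH.
Qed.

(** Stripping a coordinate enlarges the parameter space by a copy of R. This is why measurability
    carries an arbitrary parameter space: it lets the induction in [measurable_gauss_exp] close. *)
Lemma kmeasurable_consv k d (T : measurableType d) (f : T -> 'rV[R]_k.+1 -> \bar R) :
  kmeasurable f -> kmeasurable (fun (z : T * R) y => f z.1 (consv z.2 y)).
Proof.
move=> mf d' T' h c mh mc.
pose c' (i : 'I_k.+1) : T' -> R :=
  if unlift ord0 i is Some j then c j else (fun t => (h t).2).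
rewrite (_ : (fun _ => _) = (fun t => f (h t).1 (\row_i c' i t))).
  apply: (mf _ _ (fun t => (h t).1)) => [|i].
    exact: measurableT_comp.
  rewrite /c'; case: unliftP => [j _|_]; first exact: mc.
  exact: measurableT_comp.
apply/funext => t; congr f.
rewrite -(consv_row (c' ^~ t)) /c' unlift_none; congr consv.
by apply/rowP => i; rewrite !mxE liftK.
Qed.

Lemma measurable_gauss_exp k d (T : measurableType d) (f : T -> 'rV[R]_k -> \bar R) :
  kmeasurable f -> (forall t x, 0 <= f t x)%E ->
  measurable_fun setT (fun t => gauss_exp (f t)).
Proof.
elim: k d T f => [|k IH] d T f mf f0.
  have := mf _ _ id (fun _ _ => 0) (@measurable_id _ _ _) (fun=> measurable_cst _).
  congr measurable_fun; apply/funext => t /=; congr f.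
  by apply/rowP => -[].
apply: (measurable_gauss1 (g := fun z => gauss_exp (fun y => f z.1 (consv z.2 y)))).
  by apply: (IH _ _ (fun (z : T * R) y => f z.1 (consv z.2 y))) => //; exact: kmeasurable_consv.
by move=> z; exact: gauss_exp_ge0.
Qed.

Definition measurable_rv k (f : 'rV[R]_k -> \bar R) :=
  kmeasurable (fun _ : unit => f).

Lemma measurable_rv_consv k (f : 'rV[R]_k.+1 -> \bar R) t :
  measurable_rv f -> measurable_rv (fun y => f (consv t y)).
Proof.
move=> /kmeasurable_consv mf d' T' h c mh mc.
apply: (mf _ _ (fun x => (h x, t)) c) => //.
by apply/measurable_fun_pair.
Qed.

Lemma measurable_rv_gauss_exp k (f : 'rV[R]_k.+1 -> \bar R) :
  measurable_rv f -> (forall x, 0 <= f x)%E ->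
  measurable_fun setT (fun t => gauss_exp (fun y => f (consv t y))).
Proof.
move=> /kmeasurable_consv mf f0.
apply: (@measurable_gauss_exp _ _ R (fun t y => f (consv t y))) => //.
move=> d' T' h c mh mc.
apply: (mf _ _ (fun x => (tt, h x)) c) => //.
by apply/measurable_fun_pair.
Qed.

Lemma gauss_expD k (f g : 'rV[R]_k -> \bar R) :
  measurable_rv f -> measurable_rv g ->
  (forall x, 0 <= f x)%E -> (forall x, 0 <= g x)%E ->
  gauss_exp (fun x => f x + g x)%E = (gauss_exp f + gauss_exp g)%E.
Proof.
elim: k f g => [//|k IH] f g mf mg f0 g0.
rewrite !gauss_expS -gauss1D; first last.
- by move=> t; exact: gauss_exp_ge0.
- by move=> t; exact: gauss_exp_ge0.
- exact: measurable_rv_gauss_exp.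
- exact: measurable_rv_gauss_exp.
congr gauss1; apply/funext => t; rewrite IH//; exact: measurable_rv_consv.
Qed.

Lemma gauss_expZ k (c : R) (f : 'rV[R]_k -> \bar R) :
  measurable_rv f -> (forall x, 0 <= f x)%E -> 0 <= c ->
  gauss_exp (fun x => c%:E * f x)%E = (c%:E * gauss_exp f)%E.
Proof.
elim: k f => [//|k IH] f mf f0 c0.
rewrite !gauss_expS -gauss1Z//; first last.
- by move=> t; exact: gauss_exp_ge0.
- exact: measurable_rv_gauss_exp.
congr gauss1; apply/funext => t; rewrite IH//; exact: measurable_rv_consv.
Qed.

Lemma gauss_exp0 k : gauss_exp (fun _ : 'rV[R]_k => 0%E) = 0%E.
Proof.
by elim: k => [//|k IH]; rewrite gauss_expS IH gauss1_cst.
Qed.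

Lemma measurable_rv_dotv k (w : 'rV[R]_k) d (T : measurableType d) (c : 'I_k -> T -> R) :
  (forall i, measurable_fun setT (c i)) ->
  measurable_fun setT (fun t => dotv w (\row_i c i t)).
Proof.
move=> mc; rewrite /dotv.
under eq_fun do under eq_bigr do rewrite mxE.
apply: measurable_sum => i; exact: measurable_funM.
Qed.

Lemma dotv_consv k (w : 'rV[R]_k.+1) t y :
  dotv w (consv t y) = w 0 ord0 * t + dotv (\row_i w 0 (lift ord0 i)) y.
Proof.
rewrite /dotv big_ord_recl consv0; congr (_ + _).
by apply: eq_bigr => i _; rewrite consvS mxE.
Qed.

Lemma dotv_recl k (w v : 'rV[R]_k.+1) :
  dotv w v = w 0 ord0 * v 0 ord0 +
    dotv (\row_i w 0 (lift ord0 i)) (\row_i v 0 (lift ord0 i)).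
Proof.
by rewrite /dotv big_ord_recl; congr (_ + _); apply: eq_bigr => i _; rewrite !mxE.
Qed.

(* [p, q, r] are the entries of a Cholesky factor of the Gram matrix of [w, v]. *)
Lemma gauss_exp_two_forms k (w v : 'rV[R]_k) : exists p q r,
  [/\ p ^+ 2 = dotv w w, p * q = dotv w v, q ^+ 2 + r ^+ 2 = dotv v v &
   forall g : R * R -> \bar R, measurable_fun setT g -> (forall z, 0 <= g z)%E ->
   gauss_exp (fun x => g (dotv w x, dotv v x)) =
   gauss2 (fun z => g (p * z.1, q * z.1 + r * z.2))].
Proof.
elim: k w v => [|k IH] w v.
  exists 0, 0, 0; rewrite /dotv !big_ord0; split; [ring|ring|ring|].
  move=> g mg g0 /=; rewrite !big_ord0 /gauss2.
  rewrite -[LHS]gauss1_cst//; congr gauss1; apply/funext => x.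
  rewrite -[LHS]gauss1_cst//; congr gauss1; apply/funext => y.
  by rewrite !mul0r addr0.
pose w' := \row_i w 0 (lift ord0 i); pose v' := \row_i v 0 (lift ord0 i).
have [p [q [r [pE qE rE gE]]]] := IH w' v'.
have [p' [q' [r' [pE' qE' rE' gE']]]] := gauss3_merge (w 0 ord0) (v 0 ord0) p q r.
exists p', q', r'; split.
- by rewrite pE' pE dotv_recl expr2.
- by rewrite qE' qE dotv_recl.
- by rewrite rE' rE dotv_recl expr2.
move=> g mg g0; rewrite -(gE' g mg g0) gauss_expS.
congr gauss1; apply/funext => t.
(* For fixed t the first coordinate is absorbed into the test function, so the induction hypothesis,
   which holds for every test function, applies to the tails. *)
pose g' (z : R * R) := g (w 0 ord0 * t + z.1, v 0 ord0 * t + z.2).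
have mg' : measurable_fun setT g'.
  apply: measurableT_comp => //; apply/measurable_fun_pair => /=; exact: measurable_funD.
transitivity (gauss_exp (fun x => g' (dotv w' x, dotv v' x))).
  by congr gauss_exp; apply/funext => y; rewrite !dotv_consv.
by rewrite (gE g' mg')// => z; exact: g0.
Qed.

End MultivariateGaussianExpectation.

(** * Derivative rules in pointwise form, and improper integrals over a ray *)

Section RealDerivatives.
Context {R : realType}.
Implicit Types (f g : R -> R) (x df dg : R).

Lemma is_derive1C (c x : R) : is_derive x 1 (fun=> c) 0.
Proof. exact: is_derive_cst. Qed.

Lemma is_derive1I x : is_derive x 1 (fun y => y) 1.
Proof. exact: is_derive_id. Qed.

Lemma is_derive1D f g x df dg : is_derive x 1 f df -> is_derive x 1 g dg ->
  is_derive x 1 (fun y => f y + g y) (df + dg).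
Proof. by move=> hf hg; exact: is_deriveD. Qed.

Lemma is_derive1N f x df : is_derive x 1 f df -> is_derive x 1 (fun y => - f y) (- df).
Proof. by move=> hf; exact: is_deriveN. Qed.

Lemma is_derive1M f g x df dg : is_derive x 1 f df -> is_derive x 1 g dg ->
  is_derive x 1 (fun y => f y * g y) (df * g x + f x * dg).
Proof.
move=> hf hg; apply: (is_derive_eq (@is_deriveM R _ f g x 1 df dg hf hg)).
by rewrite /GRing.scale /= addrC mulrC.
Qed.

Lemma is_derive1X f x df n : is_derive x 1 f df ->
  is_derive x 1 (fun y => f y ^+ n.+1) (n.+1%:R * f x ^+ n * df).
Proof.
move=> hf; elim: n => [|n IH]; first by rewrite expr0 !mul1r.
under eq_fun do rewrite exprS.
apply: (is_derive_eq (is_derive1M hf IH)).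
by rewrite -[n.+2]addn1 natrD exprS; ring.
Qed.

Lemma is_derive1_chain (h : R -> R) f x df dh : is_derive x 1 f df -> is_derive (f x) 1 h dh ->
  is_derive x 1 (fun y => h (f y)) (dh * df).
Proof. by move=> hf hh; exact: is_derive1_comp. Qed.

Lemma is_derive1V f x df : is_derive x 1 f df -> f x != 0 ->
  is_derive x 1 (fun y => (f y)^-1) (- df / f x ^+ 2).
Proof.
move=> hf f0; apply: (is_derive_eq (is_deriveV f0 hf)).
by rewrite /GRing.scale /=; ring.
Qed.

Lemma is_derive1_sum n (F : 'I_n -> R -> R) (dF : 'I_n -> R) (P : pred 'I_n) x :
  (forall i, P i -> is_derive x 1 (F i) (dF i)) ->
  is_derive x 1 (fun y => \sum_(i | P i) F i y) (\sum_(i | P i) dF i).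
Proof.
move=> hF; rewrite (_ : (fun y => _) = \sum_(i | P i) F i); last first.
  by apply/funext => y; rewrite fct_sumE.
elim/big_ind2: _ => [|f df g dg hf hg|i Pi]; [exact: is_derive1C|exact: is_derive1D|exact: hF].
Qed.

Lemma is_derive_continuous f x df : is_derive x 1 f df -> {for x, continuous f}.
Proof.
by move=> [hf _]; apply: differentiable_continuous; apply/derivable1_diffP.
Qed.

Lemma cvgy_bounded_inv f (C : R) : (forall x, 1 <= x -> `|f x| <= C / x) ->
  f x @[x --> +oo%R] --> 0.
Proof.
move=> fC; apply/cvgrPdist_le => e e0; near=> x.
rewrite sub0r normrN.
have x1 : 1 <= x by near: x; exact: nbhs_pinfty_ge.
have x0 : 0 < x by rewrite (lt_le_trans ltr01).
apply: (le_trans (fC x x1)).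
rewrite ler_pdivrMr// mulrC -ler_pdivrMr//.
Unshelve. all: by end_near. Qed.

Lemma ge0_integral_ray f F (a l : R) : (forall x, a <= x -> 0 <= f x) ->
  continuous f -> (forall x, is_derive x 1 F (f x)) ->
  F x @[x --> +oo%R] --> l ->
  (\int[@lebesgue_measure R]_(x in `[a, +oo[) (f x)%:E = (l - F a)%:E)%E.
Proof.
move=> f0 cf dF Fl; rewrite EFinB; apply: ge0_continuous_FTC2y => //.
- exact: continuous_subspaceT.
- apply: cvg_at_right_filter; exact: (is_derive_continuous (dF a)).
- by move=> x _; rewrite derive1E; have [_ ->] := dF x.
Qed.

End RealDerivatives.

(** * The correlation integral of two rectified forms in the plane *)

Section HalfGaussian.
Context {R : realType}.
Local Notation mu := (@lebesgue_measure R).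
Implicit Types (a b c s t x p q r : R).

Lemma relu_ge0 x : 0 <= relu x.
Proof. by rewrite /relu le_max lexx. Qed.

Lemma relu_pos x : 0 <= x -> relu x = x.
Proof. by move=> x0; rewrite /relu; apply/max_idPr. Qed.

Lemma relu_neg x : x <= 0 -> relu x = 0.
Proof. by move=> x0; rewrite /relu; apply/max_idPl. Qed.

Lemma reluM a x : 0 <= a -> relu (a * x) = a * relu x.
Proof. by move=> a0; rewrite /relu maxr_pMr// mulr0. Qed.

Lemma measurable_relu : measurable_fun setT (@relu R).
Proof. exact: measurable_maxr. Qed.

Lemma integral_relu_ray (f : R -> R) a :
  (forall x, x < a -> f x = 0) ->
  (\int[mu]_x (f x)%:E = \int[mu]_(x in `[a, +oo[) (f x)%:E)%E.
Proof.
move=> fa; rewrite [RHS]integral_mkcond; apply: eq_integral => x _.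
rewrite patchE; case: ifPn => //; rewrite notin_setE /= in_itv /= andbT => /negP.
by rewrite -ltNge => /fa ->.
Qed.

(** The exponent 3 collects one factor from each [relu] and one from the Jacobian of y = x t; a
    stands for 1 + t^2, hence the lower bound 1. *)
Lemma integral_relu3_gauss a : 1 <= a ->
  (\int[mu]_x (relu x ^+ 3 * expR (- (a * x ^+ 2 / 2)))%:E = (2 / a ^+ 2)%:E)%E.
Proof.
move=> a1; have a0 : 0 < a by rewrite (lt_le_trans ltr01).
have an0 : a != 0 by rewrite gt_eqF.
rewrite (@integral_relu_ray _ 0); last first.
  by move=> x x0; rewrite relu_neg ?ltW// expr0n/= mul0r.
pose f x := x ^+ 3 * expR (- (a * x ^+ 2 / 2)).
(* With y = a x^2 / 2 this primitive is - (2 / a^2) (1 + y) exp (- y), the form in which its decay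
   is estimated. *)
pose F x := - (x ^+ 2 / a + 2 / a ^+ 2) * expR (- (a * x ^+ 2 / 2)).
transitivity (\int[mu]_(x in `[0%R, +oo[) (f x)%:E)%E.
  apply: eq_integral => x; rewrite inE /= in_itv /= andbT => x0.
  by rewrite relu_pos.
have dF x : is_derive x 1 F (f x).
  rewrite /F /f; apply: is_derive_eq.
  by rewrite /GRing.scale /=; field.
have df x : is_derive x 1 f (3 * x ^+ 2 * expR (- (a * x ^+ 2 / 2)) +
   x ^+ 3 * (expR (- (a * x ^+ 2 / 2)) * (- (a * x)))).
  rewrite /f; apply: is_derive_eq.
  by rewrite /GRing.scale /=; field.
rewrite (@ge0_integral_ray _ f F 0 0)//.
- rewrite /F; congr EFin; rewrite !expr0n /= !mul0r !mulr0 mul0r oppr0 expR0; ring.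
- by move=> x x0; rewrite /f mulr_ge0 ?exprn_ge0 ?expR_ge0.
- by move=> x; exact: (is_derive_continuous (df x)).
(* 16 is 2 * 8: the factor 2 / a^2 is at most 2, and (1 + y) exp (- y) <= 8 / x follows from exp y
   >= (1 + y / 2)^2 and x <= 2 y. *)
apply: (@cvgy_bounded_inv _ _ 16) => x x1.
have x0 : 0 < x by rewrite (lt_le_trans ltr01).
pose y := a * x ^+ 2 / 2.
have yx : x / 2 <= y.
  rewrite /y ler_pM2r ?invr_gt0//; have := mulr_ge0 (ltW x0) (ltW x0); nra.
have FE : F x = - (2 / a ^+ 2 * ((1 + y) * expR (- y))) by rewrite /F /y; field.
have y0 : 0 < y by lra.
have ey : (1 + y / 2) ^+ 2 <= expR y.
  rewrite (_ : y = y / 2 + y / 2); last by lra.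
  rewrite expRD -expr2 (_ : (y / 2 + y / 2) / 2 = y / 2); last by lra.
  by apply: lerXn2r; rewrite ?nnegrE ?expR_ge0 ?expR_ge1Dx//; lra.
have bnd : (1 + y) * expR (- y) <= 8 / x.
  rewrite expRN ler_pdivrMr ?expR_gt0// mulrAC ler_pdivlMr//.
  apply: (@le_trans _ _ (8 * (1 + y / 2) ^+ 2)); last by rewrite ler_pM2l.
  apply: (@le_trans _ _ ((1 + y) * (2 * y))); first by apply: ler_wpM2l; lra.
  nra.
have g0 : 0 <= (1 + y) * expR (- y) by rewrite mulr_ge0 ?expR_ge0//; lra.
have a2 : 0 <= 2 / a ^+ 2 <= 2.
  rewrite divr_ge0 ?sqr_ge0//= ler_pdivrMr ?exprn_gt0//; nra.
case/andP: a2 => a20 a22.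
rewrite FE normrN (ger0_norm (mulr_ge0 a20 g0)).
apply: (@le_trans _ _ (2 * (8 / x))); first exact: ler_pM.
by rewrite mulrA -natrM.
Qed.

(* Substitute [y = x t] in the half-plane [x > 0], then integrate out [x]. *)
Lemma gauss2_relu p q r : 0 <= p ->
  gauss2 (fun z => (relu (p * z.1) * relu (q * z.1 + r * z.2))%:E) =
  (\int[mu]_t (p / pi * (relu (q + r * t) / (1 + t ^+ 2) ^+ 2))%:E)%E.
Proof.
move=> p0; have pin0 : pi != 0 :> R by rewrite gt_eqF ?pi_gt0.
have alg (x e u : R) : x * (e / (2 * pi) * (p * x * (x * u))) =
    x ^+ 3 * e * (p / (2 * pi) * u).
  by ring.
pose g z : R := relu (p * z.1) * relu (q * z.1 + r * z.2).
pose H z : R := relu z.1 ^+ 3 * expR (- ((1 + z.2 ^+ 2) * z.1 ^+ 2 / 2)) *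
  (p / (2 * pi) * relu (q + r * z.2)).
have mg : measurable_fun setT g.
  apply: measurable_funM; apply: (measurableT_comp measurable_relu).
    exact: measurable_funM.
  exact: measurable_linear2.
have mH : measurable_fun setT H.
  apply: measurable_funM; first apply: measurable_funM.
  - apply: measurable_funX; apply: (measurableT_comp measurable_relu); exact: measurable_fst.
  - apply: measurableT_comp => //; apply: measurableT_comp => //.
    apply: measurable_funM => //; apply: measurable_funM; last first.
      by apply: measurable_funX; exact: measurable_fst.
    by apply: measurable_funD => //; apply: measurable_funX; exact: measurable_snd.
  - apply: measurable_funM => //; apply: (measurableT_comp measurable_relu).
    by apply: measurable_funD => //; exact: measurable_funM.
have H0 z : 0 <= H z.
  by rewrite /H !mulr_ge0 ?exprn_ge0 ?relu_ge0 ?expR_ge0 ?invr_ge0 ?mulr_ge0 ?pi_ge0.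
have mK : measurable_fun setT (fun z => (gauss_pdf z.1 * gauss_pdf z.2)%:E * (g z)%:E)%E.
  apply: emeasurable_funM; last exact/measurable_EFinP.
  apply/measurable_EFinP; apply: measurable_funM; apply: (measurableT_comp measurable_gauss_pdf).
    exact: measurable_fst.
  exact: measurable_snd.
rewrite gauss2E; first last.
- by move=> z; rewrite lee_fin mulr_ge0 ?relu_ge0.
- exact/measurable_EFinP.
transitivity (int2 (EFin \o H)).
  apply: eq_integral => x _ /=.
  (* On the half-plane x <= 0 both sides vanish: as p >= 0, the factor [relu (p * x)] is zero
     there. *)
  have [x0|x0] := leP x 0.
    rewrite !integral0_eq//.
      by move=> y _; rewrite /H /= (relu_neg x0) expr0n /= !mul0r.
    by move=> y _; rewrite relu_neg ?mul0r ?mule0 ?mulr0// mulr_ge0_le0.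
  rewrite (@ge0_integral_affine _ x 0)//; last 2 first.
  - exact: (measurable_fun_pair2 x mK).
  - move=> y; rewrite mule_ge0// lee_fin mulr_ge0 ?gauss_pdf_ge0 ?relu_ge0//.
  rewrite -ge0_integralZl//; first last.
  - by rewrite lee_fin ltW.
  - move=> y _; rewrite mule_ge0// lee_fin mulr_ge0 ?gauss_pdf_ge0 ?relu_ge0//.
  - apply: (measurableT_comp (measurable_fun_pair2 x mK)).
    by apply: measurable_funD => //; exact: measurable_funM.
  apply: eq_integral => t _; rewrite -!EFinM; congr EFin.
  rewrite gauss_pdf_mulE addr0 /H /= (relu_pos (ltW x0)) reluM// (relu_pos (ltW x0)).
  have -> : q * x + r * (x * t) = x * (q + r * t) by ring.
  rewrite reluM ?ltW//.
  have -> : - (x ^+ 2 + (x * t) ^+ 2) / 2 = - ((1 + t ^+ 2) * x ^+ 2 / 2) by field.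
  exact: alg.
rewrite /int2; etransitivity.
  apply: fubini_tonelli; first exact/measurable_EFinP.
  by move=> z; rewrite lee_fin.
apply: eq_integral => t _ /=; rewrite /H /=.
under eq_integral do rewrite EFinM.
rewrite ge0_integralZr//; first last.
- by rewrite lee_fin mulr_ge0 ?relu_ge0 ?divr_ge0 ?mulr_ge0 ?pi_ge0.
- by move=> x _; rewrite lee_fin mulr_ge0 ?exprn_ge0 ?relu_ge0 ?expR_ge0.
- apply/measurable_EFinP; apply: measurable_funM.
    by apply: measurable_funX; exact: measurable_relu.
  apply: measurableT_comp => //; apply: measurableT_comp => //.
  by apply: measurable_funM => //; apply: measurable_funM => //; exact: measurable_funX.
rewrite integral_relu3_gauss; last by rewrite lerDl sqr_ge0.
rewrite -EFinM; congr EFin.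
have t0 : 1 + t ^+ 2 != 0 by rewrite gt_eqF// ltr_pwDl// sqr_ge0.
move: pi pin0 (relu _) (1 + _) t0 => P P0 u v v0; field.
by apply/andP.
Qed.

Lemma oneD_sqr_neq0 x : 1 + x ^+ 2 != 0.
Proof. by rewrite gt_eqF// ltr_pwDl// sqr_ge0. Qed.

(** A primitive of (q + r x) / (1 + x^2)^2; only its [atan] term survives at infinity, with limit q
    pi / 4. *)
Definition ratio_prim q r x : R := q * (x / (2 * (1 + x ^+ 2)) + atan x / 2) - r / (2 * (1 + x ^+ 2)).

Lemma is_derive_ratio_prim q r x :
  is_derive x 1 (ratio_prim q r) ((q + r * x) / (1 + x ^+ 2) ^+ 2).
Proof.
have x0 := oneD_sqr_neq0 x.
have d1 : is_derive x 1 (fun y : R => (2 * (1 + y ^+ 2))^-1)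
    (- (4 * x) / (2 * (1 + x ^+ 2)) ^+ 2).
  have h : is_derive x 1 (fun y : R => 2 * (1 + y ^+ 2)) (4 * x).
    by apply: is_derive_eq; rewrite /GRing.scale /=; ring.
  by apply: is_derive1V h _; rewrite mulf_neq0.
have d2 := is_derive1D (is_derive1M (is_derive1I x) d1) (is_derive1M (is_derive1_atan x) (is_derive1C 2^-1 x)).
apply: (is_derive_eq (is_derive1D (is_derive1M (is_derive1C q x) d2) (is_derive1N (is_derive1M (is_derive1C r x) d1)))).
(* The rules produce q (v - x^2) where q is wanted; v is kept abstract for [field] and the identity
   v - x^2 = 1 is applied afterwards. *)
have [v vE] : exists v, v = 1 + x ^+ 2 by exists (1 + x ^+ 2).
rewrite -vE in x0 *; transitivity ((q * (v - x ^+ 2) + r * x) / v ^+ 2); first by field.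
by rewrite vE; congr (_ / _); ring.
Qed.

Lemma continuous_ratio q r : continuous (fun x : R => (q + r * x) / (1 + x ^+ 2) ^+ 2).
Proof.
move=> x; have x0 := oneD_sqr_neq0 x.
have h : is_derive x 1 (fun y : R => (1 + y ^+ 2) ^+ 2) (2 * (1 + x ^+ 2) * (2 * x)).
  by apply: is_derive_eq; rewrite /GRing.scale /=; ring.
have n0 : (1 + x ^+ 2) ^+ 2 != 0 by rewrite expf_neq0.
have := is_derive1M (is_derive1D (is_derive1C q x) (is_derive1M (is_derive1C r x) (is_derive1I x))) (is_derive1V h n0).
exact: is_derive_continuous.
Qed.

Lemma cvgy_ratio_prim q r : ratio_prim q r x @[x --> +oo%R] --> q * (pi / 4).
Proof.
have c1 : (fun x : R => x / (2 * (1 + x ^+ 2))) x @[x --> +oo%R] --> 0.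
  apply: (@cvgy_bounded_inv _ _ 1) => x x1; have x0 : 0 < x by rewrite (lt_le_trans ltr01).
  have v0 : 0 < 1 + x ^+ 2 by rewrite ltr_pwDl// sqr_ge0.
  rewrite ger0_norm; last by rewrite divr_ge0 ?mulr_ge0// ltW.
  by rewrite ler_pdivrMr ?mulr_gt0// mulrAC ler_pdivlMr//; nra.
have c2 : (fun x : R => r / (2 * (1 + x ^+ 2))) x @[x --> +oo%R] --> 0.
  apply: (@cvgy_bounded_inv _ _ `|r|) => x x1; have x0 : 0 < x by rewrite (lt_le_trans ltr01).
  have v0 : 0 < 1 + x ^+ 2 by rewrite ltr_pwDl// sqr_ge0.
  rewrite normrM normfV (@ger0_norm _ (2 * _)); last by rewrite mulr_ge0// ltW.
  by rewrite ler_wpM2l// lef_pV2 ?posrE ?mulr_gt0//; nra.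
rewrite (_ : q * (pi / 4) = q * (0 + pi / 2 / 2) - 0); last by field.
apply: cvgB; last exact: c2.
apply: cvgM; first exact: cvg_cst.
apply: cvgD; first exact: c1.
by apply: cvgM; [exact: cvgy_atan|exact: cvg_cst].
Qed.

(** The integrand lives on t >= - q / r, and evaluating the primitive at that endpoint yields the
    arctangent. As q / r is the cotangent of the angle theta between the forms, pi / 2 + atan (q /
    r) is pi - theta. *)
Lemma gauss2_relu_nondegenerate p q r : 0 <= p -> 0 < r ->
  gauss2 (fun z => (relu (p * z.1) * relu (q * z.1 + r * z.2))%:E) =
  (p / (2 * pi) * (q * (pi / 2 + atan (q / r)) + r))%:E.
Proof.
move=> p0 r0; rewrite gauss2_relu//.
have rn0 : r != 0 by rewrite gt_eqF.
pose a := - (q / r).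
have ra x : (0 <= q + r * x) = (a <= x).
  by rewrite /a lerNl ler_pdivlMr// mulNr -[RHS]subr_ge0 opprK [x * r]mulrC.
rewrite (@integral_relu_ray _ a); last first.
  move=> x xa; rewrite relu_neg ?mul0r ?mulr0//.
  by apply/ltW; rewrite ltNge ra -ltNge.
pose f x : R := p / pi * ((q + r * x) / (1 + x ^+ 2) ^+ 2).
transitivity (\int[mu]_(x in `[a, +oo[) (f x)%:E)%E.
  apply: eq_integral => x; rewrite inE /= in_itv /= andbT -ra => x0.
  by rewrite relu_pos.
have dF x : is_derive x 1 (fun x => p / pi * ratio_prim q r x) (f x).
  apply: (is_derive_eq (is_derive1M (is_derive1C _ x) (is_derive_ratio_prim q r x))).
  by rewrite /f mul0r add0r.
rewrite (@ge0_integral_ray _ f (fun x => p / pi * ratio_prim q r x) a (p / pi * (q * (pi / 4))) _ _ dF).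
- congr EFin; rewrite /ratio_prim /a atanN.
  have s0 : r ^+ 2 + q ^+ 2 != 0 by rewrite gt_eqF// ltr_pwDl ?sqr_ge0// exprn_gt0.
  have -> : 1 + (- (q / r)) ^+ 2 = (r ^+ 2 + q ^+ 2) / r ^+ 2 by field.
  have : pi != 0 :> R by rewrite gt_eqF ?pi_gt0.
  by move: pi (atan _) => P A P0; field; rewrite rn0 s0 P0.
- move=> x ax; rewrite /f mulr_ge0 ?divr_ge0 ?pi_ge0 ?sqr_ge0//.
  by rewrite ra.
- move=> x; apply: cvgM; [exact: cvg_cst|exact: continuous_ratio].
- by apply: cvgM; [exact: cvg_cst|exact: cvgy_ratio_prim].
Qed.

(** The case of two equal forms, where r = 0 and there is no endpoint: the integrand is even, and
    twice its integral over t >= 0 is 2 (p / pi) (p pi / 4). *)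
Lemma gauss2_relu_sqr p : 0 <= p ->
  gauss2 (fun z => (relu (p * z.1) * relu (p * z.1 + 0 * z.2))%:E) = (p ^+ 2 / 2)%:E.
Proof.
move=> p0; rewrite gauss2_relu//.
pose f x : R := p / pi * ((p + 0 * x) / (1 + x ^+ 2) ^+ 2).
have f0 x : 0 <= f x.
  by rewrite /f mul0r addr0 mulr_ge0 ?divr_ge0 ?pi_ge0 ?sqr_ge0.
have cf : continuous f.
  move=> x; apply: cvgM; [exact: cvg_cst|exact: continuous_ratio].
transitivity (\int[mu]_x (f x)%:E)%E.
  by apply: eq_integral => x _; rewrite /f mul0r addr0 relu_pos.
rewrite ge0_symfun_integralT//; last first.
  by move=> x; rewrite /f /= sqrrN !mul0r.
rewrite (_ : [set x | _] = `[0, +oo[%classic); last first.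
  by apply/seteqP; split => x /=; rewrite in_itv/= andbT.
have dF x : is_derive x 1 (fun x => p / pi * ratio_prim p 0 x) (f x).
  apply: (is_derive_eq (is_derive1M (is_derive1C _ x) (is_derive_ratio_prim p 0 x))).
  by rewrite /f mul0r add0r.
rewrite (@ge0_integral_ray _ f (fun x => p / pi * ratio_prim p 0 x) 0 (p / pi * (p * (pi / 4))) _ _ dF).
- rewrite -EFinM; congr EFin; rewrite /ratio_prim atan0 !mul0r.
  have : pi != 0 :> R by rewrite gt_eqF ?pi_gt0.
  by move: pi => P P0; field.
- by move=> x _; exact: f0.
- exact: cf.
- by apply: cvgM; [exact: cvg_cst|exact: cvgy_ratio_prim].
Qed.

(** Both sides are the angle in (0, pi) with cotangent q / r. *)
Lemma acos_atan q r : 0 < r ->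
  acos (q / Num.sqrt (q ^+ 2 + r ^+ 2)) = pi / 2 - atan (q / r).
Proof.
move=> r0.
have -> : q / Num.sqrt (q ^+ 2 + r ^+ 2) = cos (pi / 2 - atan (q / r)).
  have s0 : 0 < q ^+ 2 + r ^+ 2 by rewrite ltr_wpDl ?sqr_ge0// exprn_gt0.
  have cn0 : cos (atan (q / r)) != 0.
    by rewrite cos_atan invr_neq0// gt_eqF// sqrtr_gt0 ltr_pwDl// sqr_ge0.
  have sE : sin (atan (q / r)) = q / r * cos (atan (q / r)).
    by rewrite -{2}(atanK (q / r)) /tan divfK.
  rewrite cosB cos_pihalf sin_pihalf mul0r add0r mul1r sE cos_atan.
  have -> : 1 + (q / r) ^+ 2 = (q ^+ 2 + r ^+ 2) / r ^+ 2.
    by field; rewrite gt_eqF.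
  rewrite sqrtrM ?ltW// sqrtrV ?sqr_ge0// sqrtr_sqr gtr0_norm//.
  by field; rewrite !gt_eqF// sqrtr_gt0.
rewrite cosK// in_itv /=; have := atan_ltpi2 (q / r); have := atan_gtNpi2 (q / r).
have := @pi_gt0 R; move: pi (atan _) => P A; lra.
Qed.

(** The reflection is the trace on one axis of the half turn of the plane, the second coordinate
    being a dummy. *)
Lemma gauss1_opp (f : R -> \bar R) : measurable_fun setT f -> (forall x, 0 <= f x)%E ->
  gauss1 (fun x => f (- x)) = gauss1 f.
Proof.
move=> mf f0.
have cs : (-1) ^+ 2 + 0 ^+ 2 = 1 :> R by ring.
have mf1 : measurable_fun setT (fun z : R * R => f z.1).
  by apply: (measurableT_comp mf); exact: measurable_fst.
have := gauss2_rotation cs mf1 (fun z => f0 z.1).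
have -> : gauss2 (fun z : R * R => f z.1) = gauss1 f.
  by congr gauss1; apply/funext => x; exact: (gauss1_cst (f0 x)).
move=> ->; rewrite /gauss2; congr gauss1; apply/funext => x.
by rewrite -[LHS]gauss1_cst//; congr gauss1; apply/funext => y /=; congr f; ring.
Qed.

End HalfGaussian.

(** * Closed form and finiteness of correlations; expansion of the objective *)

Section ReluCorrelation.
Context {R : realType}.
Implicit Types (p q r A B C : R).

(** Signs are normalized by symmetries that preserve the Gram matrix: a half turn negates p, q and r
    together, and reflecting the second coordinate negates r alone. *)
Lemma gauss_exp_two_forms_ge0 k (w v : 'rV[R]_k) : exists p q r,
  [/\ 0 <= p, 0 <= r & [/\ p ^+ 2 = dotv w w, p * q = dotv w v, q ^+ 2 + r ^+ 2 = dotv v v &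
   forall g : R * R -> \bar R, measurable_fun setT g -> (forall z, 0 <= g z)%E ->
   gauss_exp (fun x => g (dotv w x, dotv v x)) =
   gauss2 (fun z => g (p * z.1, q * z.1 + r * z.2))]].
Proof.
have [p [q [r [p0 [pE qE rE gE]]]]] : exists p q r,
  [/\ 0 <= p & [/\ p ^+ 2 = dotv w w, p * q = dotv w v, q ^+ 2 + r ^+ 2 = dotv v v &
   forall g : R * R -> \bar R, measurable_fun setT g -> (forall z, 0 <= g z)%E ->
   gauss_exp (fun x => g (dotv w x, dotv v x)) =
   gauss2 (fun z => g (p * z.1, q * z.1 + r * z.2))]].
  have [p [q [r [pE qE rE gE]]]] := gauss_exp_two_forms w v.
  have [p0|p0] := leP 0 p; first by exists p, q, r.
  exists (- p), (- q), (- r); split; first by rewrite oppr_ge0 ltW.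
  split; [by rewrite sqrrN|by rewrite mulrNN|by rewrite !sqrrN|].
  move=> g mg g0; rewrite (gE g mg g0).
  have cs : (-1) ^+ 2 + 0 ^+ 2 = 1 :> R by ring.
  have mg1 : measurable_fun setT (g \o lin2 p 0 q r) by exact: measurable_comp_lin2.
  transitivity (gauss2 (g \o lin2 p 0 q r)).
    congr gauss2; apply/funext => z /=; rewrite /lin2; congr (g (_, _)); ring.
  rewrite (gauss2_rotation cs mg1); last by move=> z; exact: g0.
  congr gauss2; apply/funext => z /=; rewrite /lin2 /=; congr (g (_, _)); ring.
have [r0|r0] := leP 0 r; first by exists p, q, r.
exists p, q, (- r); split => //; first by rewrite oppr_ge0 ltW.
split => //; first by rewrite sqrrN.
move=> g mg g0; rewrite (gE g mg g0) /gauss2; congr gauss1; apply/funext => x /=.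
have mgx : measurable_fun setT (fun y => g (p * x, q * x + - r * y)).
  apply: (measurableT_comp mg); apply/measurable_fun_pair => //=.
  by apply: measurable_funD => //; exact: measurable_funM.
rewrite -(gauss1_opp mgx (fun y => g0 _)).
by congr gauss1; apply/funext => y; congr (g (_, _)); ring.
Qed.

Definition relu2 (z : R * R) : \bar R := (relu z.1 * relu z.2)%:E.

Lemma measurable_relu2 : measurable_fun setT relu2.
Proof.
apply/measurable_EFinP; apply: measurable_funM; apply: (measurableT_comp measurable_relu).
  exact: measurable_fst.
exact: measurable_snd.
Qed.

Lemma relu2_ge0 z : (0 <= relu2 z)%E.
Proof. by rewrite lee_fin mulr_ge0 ?relu_ge0. Qed.

Definition ecorr k (w v : 'rV[R]_k) : \bar R :=
  gauss_exp (fun x => (relu (dotv w x) * relu (dotv v x))%:E).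

(** In terms of the angle t this is |w| |v| (sin t + (pi - t) cos t) / (2 pi), half of the
    arc-cosine kernel of degree one. *)
Definition relu_kernel A B C : R :=
  (2 * pi)^-1 * (Num.sqrt (A * C - B ^+ 2) +
                 (pi - acos (B / (Num.sqrt A * Num.sqrt C))) * B).

Definition gram k (w v : 'rV[R]_k) : R := dotv w w * dotv v v - dotv w v ^+ 2.

Lemma ecorr_relu_kernel k (w v : 'rV[R]_k) : 0 < gram w v ->
  ecorr w v = (relu_kernel (dotv w w) (dotv w v) (dotv v v))%:E.
Proof.
have [p [q [r [p0 r0 [pE qE rE gE]]]]] := gauss_exp_two_forms_ge0 w v.
rewrite /gram /ecorr -pE -qE -rE => g0.
(* In Cholesky coordinates the Gram determinant is (p r)^2, so its positivity forces p and r to be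
   nonzero. *)
have {g0} : 0 < (p * r) ^+ 2 by apply: lt_le_trans g0 _; rewrite le_eqVlt; apply/orP; left; apply/eqP; ring.
have pr0 : 0 <= p * r by exact: mulr_ge0.
rewrite exprn_even_gt0//= => prn0.
have pp : 0 < p by rewrite lt0r p0 andbT; apply: contraNneq prn0 => ->; rewrite mul0r.
have rp : 0 < r by rewrite lt0r r0 andbT; apply: contraNneq prn0 => ->; rewrite mulr0.
rewrite (gE relu2 measurable_relu2 relu2_ge0) gauss2_relu_nondegenerate//.
congr EFin; rewrite /relu_kernel.
have -> : p ^+ 2 * (q ^+ 2 + r ^+ 2) - (p * q) ^+ 2 = (p * r) ^+ 2 by ring.
rewrite !sqrtr_sqr !ger0_norm//.
have -> : p * q / (p * Num.sqrt (q ^+ 2 + r ^+ 2)) = q / Num.sqrt (q ^+ 2 + r ^+ 2).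
  by rewrite -mulf_div divff ?mul1r// gt_eqF.
rewrite acos_atan//; have : pi != 0 :> R by rewrite gt_eqF ?pi_gt0.
by move: pi (atan _) => P A P0; field.
Qed.

Lemma ecorr_diag k (w : 'rV[R]_k) : ecorr w w = (dotv w w / 2)%:E.
Proof.
have [p [q [r [p0 r0 [pE qE rE gE]]]]] := gauss_exp_two_forms_ge0 w w.
have [qp rp] : q = p /\ r = 0.
  move: qE rE; rewrite -pE.
  (* For p = 0 the equation p q = p^2 says nothing, but then q^2 + r^2 = 0 settles both unknowns. *)
  have [->|pn0] := eqVneq p 0.
    rewrite expr0n /= => _ /eqP; rewrite paddr_eq0 ?sqr_ge0// !sqrf_eq0.
    by move=> /andP[/eqP -> /eqP ->].
  rewrite expr2 => /(mulfI pn0) -> /eqP; rewrite -subr_eq0 expr2.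
  by rewrite addrAC subrr add0r mulf_eq0 orbb => /eqP ->.
rewrite /ecorr (gE relu2 measurable_relu2 relu2_ge0) qp rp.
by rewrite gauss2_relu_sqr// pE.
Qed.

Definition rv_measurable k (h : 'rV[R]_k -> R) :=
  forall d (T : measurableType d) (c : 'I_k -> T -> R),
    (forall i, measurable_fun setT (c i)) -> measurable_fun setT (fun t => h (\row_i c i t)).

Lemma rv_measurable_EFin k (h : 'rV[R]_k -> R) :
  rv_measurable h -> measurable_rv (fun x => (h x)%:E).
Proof. by move=> mh d T f c mf mc; apply/measurable_EFinP; exact: mh. Qed.

Lemma rv_measurableD k (h g : 'rV[R]_k -> R) :
  rv_measurable h -> rv_measurable g -> rv_measurable (fun x => h x + g x).
Proof. by move=> mh mg d T c mc; apply: measurable_funD; [exact: mh|exact: mg]. Qed.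

Lemma rv_measurableB k (h g : 'rV[R]_k -> R) :
  rv_measurable h -> rv_measurable g -> rv_measurable (fun x => h x - g x).
Proof. by move=> mh mg d T c mc; apply: measurable_funB; [exact: mh|exact: mg]. Qed.

Lemma rv_measurableM k (h g : 'rV[R]_k -> R) :
  rv_measurable h -> rv_measurable g -> rv_measurable (fun x => h x * g x).
Proof. by move=> mh mg d T c mc; apply: measurable_funM; [exact: mh|exact: mg]. Qed.

Lemma rv_measurable_relu k (w : 'rV[R]_k) : rv_measurable (fun x => relu (dotv w x)).
Proof.
move=> d T c mc; apply: (measurableT_comp measurable_relu).
exact: measurable_rv_dotv.
Qed.

(** Measurability of the sum is proved jointly because adding one more term requires it of the
    partial sum. *)
Lemma gauss_exp_sum (I : Type) (l : seq I) k (f : I -> 'rV[R]_k -> R) :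
  (forall i, rv_measurable (f i)) -> (forall i x, 0 <= f i x) ->
  rv_measurable (fun x => \sum_(i <- l) f i x) /\
  gauss_exp (fun x => (\sum_(i <- l) f i x)%:E) = (\sum_(i <- l) gauss_exp (fun x => (f i x)%:E))%E.
Proof.
move=> mf f0; elim: l => [|i l [IH1 IH2]].
  split; first by move=> d T c mc; under eq_fun do rewrite big_nil; exact: measurable_cst.
  by under eq_fun do rewrite big_nil; rewrite big_nil gauss_exp0.
split.
  rewrite (_ : (fun x => _) = (fun x => f i x + \sum_(j <- l) f j x)).
    by apply: rv_measurableD; [exact: mf|exact: IH1].
  by apply/funext => x; rewrite big_cons.
transitivity (gauss_exp (fun x => ((f i x)%:E + (\sum_(j <- l) f j x)%:E)%E)).
  by congr gauss_exp; apply/funext => x; rewrite big_cons.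
rewrite big_cons -IH2; apply: gauss_expD.
- exact: rv_measurable_EFin.
- exact: rv_measurable_EFin.
- by move=> x; rewrite lee_fin.
- by move=> x; rewrite lee_fin sumr_ge0.
Qed.

Definition corr k (w v : 'rV[R]_k) : R := fine (ecorr w v).

(** Finiteness for all pairs, parallel ones included, by a b <= a^2 + b^2 and the diagonal case. The
    comparison is made by additivity, splitting a^2 + b^2 into a b and a nonnegative remainder. *)
Lemma ecorrE k (w v : 'rV[R]_k) : ecorr w v = (corr w v)%:E.
Proof.
rewrite /corr fineK//.
pose a x : R := relu (dotv w x); pose b x : R := relu (dotv v x).
have ma := @rv_measurable_relu k w; have mb := @rv_measurable_relu k v.
have maa := rv_measurableM ma ma; have mbb := rv_measurableM mb mb.
have mab := rv_measurableM ma mb.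
have a0 x : 0 <= a x by exact: relu_ge0.
have b0 x : 0 <= b x by exact: relu_ge0.
have d0 x : 0 <= a x * a x + b x * b x - a x * b x.
  have := sqr_ge0 (a x - b x); have := mulr_ge0 (a0 x) (b0 x); nra.
have E1 : (gauss_exp (fun x => (a x * a x)%:E + (b x * b x)%:E) = ecorr w w + ecorr v v)%E.
  by apply: gauss_expD; [exact: rv_measurable_EFin|exact: rv_measurable_EFin|
   move=> x; rewrite lee_fin mulr_ge0|move=> x; rewrite lee_fin mulr_ge0].
have E2 : (gauss_exp (fun x => (a x * a x)%:E + (b x * b x)%:E) =
  ecorr w v + gauss_exp (fun x => (a x * a x + b x * b x - a x * b x)%:E))%E.
  rewrite -gauss_expD.
  - congr gauss_exp; apply/funext => x; rewrite -!EFinD; congr EFin; rewrite -/(a x) -/(b x); ring.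
  - exact: rv_measurable_EFin.
  - by apply: rv_measurable_EFin; apply: rv_measurableB => //; exact: rv_measurableD.
  - by move=> x; rewrite lee_fin mulr_ge0 ?relu_ge0.
  - by move=> x; rewrite lee_fin.
have ew0 : (0 <= ecorr w v)%E.
  by apply: gauss_exp_ge0 => x; rewrite lee_fin mulr_ge0 ?relu_ge0.
rewrite ge0_fin_numE//.
apply: (@le_lt_trans _ _ (ecorr w w + ecorr v v)%E); last first.
  by rewrite !ecorr_diag -EFinD ltry.
rewrite -E1 E2 leeDl//; apply: gauss_exp_ge0 => x; rewrite lee_fin; exact: d0.
Qed.

Lemma corr_relu_kernel k (w v : 'rV[R]_k) : 0 < gram w v ->
  corr w v = relu_kernel (dotv w w) (dotv w v) (dotv v v).
Proof. by move=> /ecorr_relu_kernel; rewrite /corr => ->. Qed.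

Lemma corr_diag k (w : 'rV[R]_k) : corr w w = dotv w w / 2.
Proof. by rewrite /corr ecorr_diag. Qed.

Lemma corr_sym k (w v : 'rV[R]_k) : corr w v = corr v w.
Proof.
by rewrite /corr /ecorr; congr (fine (gauss_exp _)); apply/funext => x; rewrite mulrC.
Qed.

Definition layer n k (U : 'M[R]_(n, k)) (x : 'rV[R]_k) : R :=
  \sum_(i < n) relu (dotv (row i U) x).

Lemma rv_measurable_layer n k (U : 'M[R]_(n, k)) : rv_measurable (layer U).
Proof.
have [//] := @gauss_exp_sum _ (index_enum 'I_n) k (fun i x => relu (dotv (row i U) x))
  (fun i => @rv_measurable_relu k (row i U)) (fun i x => relu_ge0 _).
Qed.

Lemma gauss_exp_layerM n m k (U : 'M[R]_(n, k)) (V : 'M[R]_(m, k)) :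
  gauss_exp (fun x => (layer U x * layer V x)%:E) =
  (\sum_(i < n) \sum_(j < m) corr (row i U) (row j V))%:E.
Proof.
pose f (ij : 'I_n * 'I_m) x := relu (dotv (row ij.1 U) x) * relu (dotv (row ij.2 V) x).
have [_ E] := @gauss_exp_sum _ (index_enum ('I_n * 'I_m)%type) k f
  (fun ij => rv_measurableM (@rv_measurable_relu k (row ij.1 U)) (@rv_measurable_relu k (row ij.2 V)))
  (fun ij x => mulr_ge0 (relu_ge0 _) (relu_ge0 _)).
transitivity (gauss_exp (fun x => (\sum_(ij : 'I_n * 'I_m) f ij x)%:E)).
  congr gauss_exp; apply/funext => x; congr EFin.
  by rewrite /layer big_distrlr /= pair_bigA.
rewrite E pair_bigA /= -sumEFin; apply: eq_bigr => ij _; exact: ecorrE.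
Qed.

(* The cross term is moved to the left so that every expectation is of a
   nonnegative function. *)
Lemma FobjE n k (V : 'M[R]_(k, k)) (W : 'M[R]_(n, k)) :
  Fobj V W = (\sum_(i < n) \sum_(j < n) corr (row i W) (row j W)) / 2
           + (\sum_(i < k) \sum_(j < k) corr (row i V) (row j V)) / 2
           - \sum_(i < n) \sum_(j < k) corr (row i W) (row j V).
Proof.
have mW := @rv_measurable_layer n k W; have mV := @rv_measurable_layer k k V.
have l0 m (U : 'M[R]_(m, k)) x : 0 <= layer U x by apply: sumr_ge0 => i _; exact: relu_ge0.
pose f x : R := 2^-1 * (layer W x - layer V x) ^+ 2.
have mf : rv_measurable f.
  have mB := rv_measurableB mW mV.
  move=> d T c mc; apply: measurable_funM => //; apply: measurable_funX; exact: mB.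
have f0 x : 0 <= f x by rewrite mulr_ge0 ?sqr_ge0.
have E1 := gauss_expD (rv_measurable_EFin mf) (rv_measurable_EFin (rv_measurableM mW mV))
  (fun x => f0 x) (fun x => mulr_ge0 (l0 _ W x) (l0 _ V x)).
have E2 : gauss_exp (fun x => (2^-1%:E * (layer W x * layer W x)%:E +
    2^-1%:E * (layer V x * layer V x)%:E)%E) =
    (2^-1%:E * gauss_exp (fun x => (layer W x * layer W x)%:E) +
     2^-1%:E * gauss_exp (fun x => (layer V x * layer V x)%:E))%E.
  have mWW := rv_measurable_EFin (rv_measurableM mW mW).
  have mVV := rv_measurable_EFin (rv_measurableM mV mV).
  have i2 : 0 <= 2^-1 :> R by rewrite invr_ge0.
  rewrite -(gauss_expZ mWW (fun x => mulr_ge0 (l0 _ W x) (l0 _ W x)) i2).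
  rewrite -(gauss_expZ mVV (fun x => mulr_ge0 (l0 _ V x) (l0 _ V x)) i2).
  apply: gauss_expD.
  - move=> d T h c mh mc; apply: emeasurable_funM; last exact: (mWW _ _ h c mh mc).
    exact: measurable_cst.
  - move=> d T h c mh mc; apply: emeasurable_funM; last exact: (mVV _ _ h c mh mc).
    exact: measurable_cst.
  - by move=> x; rewrite -EFinM lee_fin !mulr_ge0.
  - by move=> x; rewrite -EFinM lee_fin !mulr_ge0.
move: E1; have -> : (fun x => (f x)%:E + (layer W x * layer V x)%:E)%E =
    (fun x => (2^-1%:E * (layer W x * layer W x)%:E + 2^-1%:E * (layer V x * layer V x)%:E)%E).
  apply/funext => x; rewrite -!EFinM -!EFinD; congr EFin; by rewrite /f; field.
rewrite E2 !gauss_exp_layerM => E.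
have {}E : gauss_exp (fun x => (f x)%:E) =
  ((\sum_(i < n) \sum_(j < n) corr (row i W) (row j W)) / 2
           + (\sum_(i < k) \sum_(j < k) corr (row i V) (row j V)) / 2
           - \sum_(i < n) \sum_(j < k) corr (row i W) (row j V))%:E.
  (* An infinite expectation is excluded because its sum with the finite cross term is finite. *)
  move: E; rewrite -!EFinM -EFinD; case: (gauss_exp _) => [u|//|//] [E].
  by congr EFin; lra.
by rewrite /Fobj -[X in fine X]/(gauss_exp (fun x => (f x)%:E)) E.
Qed.

End ReluCorrelation.

(** * Gram determinants, angles, and the entries of [h1] and [h2] *)

Section DotProduct.
Context {R : realType} {k : nat}.
Implicit Types (u v w : 'rV[R]_k) (t : R).

Lemma dotvC u v : dotv u v = dotv v u.
Proof. by apply: eq_bigr => i _; rewrite mulrC. Qed.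

Lemma dotvDl u v w : dotv (u + v) w = dotv u w + dotv v w.
Proof. by rewrite /dotv -big_split; apply: eq_bigr => i _; rewrite mxE mulrDl. Qed.

Lemma dotvZl t u w : dotv (t *: u) w = t * dotv u w.
Proof. by rewrite /dotv mulr_sumr; apply: eq_bigr => i _; rewrite mxE mulrA. Qed.

Lemma dotvDr u v w : dotv w (u + v) = dotv w u + dotv w v.
Proof. by rewrite dotvC dotvDl !(dotvC w). Qed.

Lemma dotvZr t u w : dotv w (t *: u) = t * dotv w u.
Proof. by rewrite dotvC dotvZl dotvC. Qed.

Lemma dotv0l u : dotv 0 u = 0.
Proof. by rewrite -(scale0r (0 : 'rV[R]_k)) dotvZl mul0r. Qed.

Lemma dotv0r u : dotv u 0 = 0.
Proof. by rewrite dotvC dotv0l. Qed.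

Lemma dotv_deltal b u : dotv (delta_mx 0 b) u = u 0 b.
Proof.
rewrite /dotv (bigD1 b)//= big1 ?addr0 => [|i ib]; first by rewrite mxE !eqxx mul1r.
by rewrite mxE (negbTE ib) andbF mul0r.
Qed.

Lemma dotv_deltar b u : dotv u (delta_mx 0 b) = u 0 b.
Proof. by rewrite dotvC dotv_deltal. Qed.

Lemma dotvv_ge0 u : 0 <= dotv u u.
Proof. by apply: sumr_ge0 => i _; rewrite -expr2 sqr_ge0. Qed.

Lemma dotvv_gt0 u : u != 0 -> 0 < dotv u u.
Proof.
move=> u0; rewrite lt0r dotvv_ge0 andbT; apply: contraNneq u0 => uu.
apply/eqP/rowP => i; rewrite mxE; apply/eqP; rewrite -sqrf_eq0 expr2.
move/eqP: uu; rewrite psumr_eq0 => [/allP/(_ i (mem_index_enum i))//|j _].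
by rewrite -expr2 sqr_ge0.
Qed.

Lemma gramC u v : gram u v = gram v u.
Proof. by rewrite /gram (dotvC v u); ring. Qed.

(** If u.u = 0 the determinant reduces to - (u.v)^2. *)
Lemma gram_gt0l u v : 0 < gram u v -> 0 < dotv u u.
Proof.
have := dotvv_ge0 u; have := dotvv_ge0 v; have := sqr_ge0 (dotv u v); rewrite /gram.
rewrite [in X in _ -> _ -> _ -> _ -> X]lt_neqAle => b c a g; rewrite a andbT eq_sym.
by apply: contraTneq g => ->; rewrite mul0r -leNgt; lra.
Qed.

Lemma gram_gt0r u v : 0 < gram u v -> 0 < dotv v v.
Proof. by rewrite gramC => /gram_gt0l. Qed.

(* The Cholesky factor exhibits the Gram determinant as a square. *)
Lemma gram_ge0 u v : 0 <= gram u v.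
Proof.
have [p [q [r [pE qE rE _]]]] := gauss_exp_two_forms u v.
rewrite /gram -pE -qE -rE (_ : _ - _ = (p * r) ^+ 2) ?sqr_ge0//; ring.
Qed.

(** A vanishing determinant means that the cosine is 1 or -1, hence that the angle is 0 or pi. *)
Lemma angle_gram_gt0 u v : u != 0 -> v != 0 -> 0 < angle u v < pi -> 0 < gram u v.
Proof.
move=> /dotvv_gt0 u0 /dotvv_gt0 v0 /andP[a0 api].
rewrite lt0r gram_ge0 andbT; apply/eqP => g0.
have : (dotv u v / (normv u * normv v)) ^+ 2 = 1.
  rewrite exprMn exprVn exprMn !sqr_sqrtr ?ltW//.
  have -> : dotv u u * dotv v v = dotv u v ^+ 2 by move: g0; rewrite /gram => /eqP; rewrite subr_eq0 => /eqP.
  rewrite divff// expf_eq0 /=; apply/eqP => B0; move: g0; rewrite /gram B0 expr0n subr0 => /eqP.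
  by rewrite gt_eqF// mulr_gt0.
move=> /eqP; rewrite sqrf_eq1 => /orP[]/eqP e; move: a0 api; rewrite /angle e.
  by rewrite acos1 ltxx.
by rewrite acosN1 ltxx.
Qed.

Lemma gram_cos_bounds u v : 0 < gram u v -> -1 < dotv u v / (normv u * normv v) < 1.
Proof.
move=> g0; have A0 := gram_gt0l g0; have C0 := gram_gt0r g0.
have n0 : 0 < normv u * normv v by rewrite mulr_gt0 ?sqrtr_gt0.
rewrite -ltr_norml -(@ltr_pXn2r _ 2)// ?nnegrE// expr1n real_normK ?num_real//.
rewrite exprMn exprVn exprMn !sqr_sqrtr ?ltW// ltr_pdivrMr ?mulr_gt0// mul1r.
by rewrite -subr_gt0.
Qed.

Lemma angleC u v : angle u v = angle v u.
Proof. by rewrite /angle dotvC mulrC [normv u * _]mulrC mulrC. Qed.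

Lemma cos_angle u v : 0 < gram u v -> cos (angle u v) = dotv u v / (normv u * normv v).
Proof.
by move=> /gram_cos_bounds/andP[/ltW ? /ltW ?]; rewrite /angle acosK// in_itv /=; apply/andP.
Qed.

Lemma sin_angle u v : 0 < gram u v ->
  sin (angle u v) = Num.sqrt (gram u v) / (normv u * normv v).
Proof.
move=> g0; have /andP[/ltW b1 /ltW b2] := gram_cos_bounds g0.
have A0 := gram_gt0l g0; have C0 := gram_gt0r g0.
have n0 : 0 < normv u * normv v by rewrite mulr_gt0 ?sqrtr_gt0.
rewrite /angle sin_acos ?b1//.
have -> : 1 - (dotv u v / (normv u * normv v)) ^+ 2 = gram u v / (normv u * normv v) ^+ 2.
  have uE : dotv u u = normv u ^+ 2 by rewrite sqr_sqrtr// ltW.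
  have vE : dotv v v = normv v ^+ 2 by rewrite sqr_sqrtr// ltW.
  have nu : normv u != 0 by rewrite gt_eqF// sqrtr_gt0.
  have nv : normv v != 0 by rewrite gt_eqF// sqrtr_gt0.
  rewrite /gram uE vE; move: (normv u) (normv v) (dotv u v) nu nv => x y z x0 y0.
  by field; rewrite x0 y0.
by rewrite sqrtrM ?ltW// sqrtrV ?sqr_ge0// sqrtr_sqr gtr0_norm.
Qed.

(** [nvec v u] is the part of the unit vector of v orthogonal to u, so its length is the sine of the
    angle. *)
Lemma normv_nvec u v : 0 < gram u v ->
  normv (nvec v u) = Num.sqrt (gram u v) / (normv u * normv v).
Proof.
move=> g0; have A0 := gram_gt0l g0; have C0 := gram_gt0r g0.
rewrite -[RHS]ger0_norm; last by rewrite divr_ge0 ?mulr_ge0 ?sqrtr_ge0.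
rewrite -sqrtr_sqr /normv; congr Num.sqrt.
have nu : normv u != 0 by rewrite gt_eqF// sqrtr_gt0.
have nv : normv v != 0 by rewrite gt_eqF// sqrtr_gt0.
have uE : dotv u u = normv u ^+ 2 by rewrite sqr_sqrtr// ltW.
have vE : dotv v v = normv v ^+ 2 by rewrite sqr_sqrtr// ltW.
rewrite exprMn sqr_sqrtr ?ltW// -/(normv u) -/(normv v) exprVn /gram.
rewrite /nvec cos_angle 1?gramC// /unitv -scaleNr !(dotvDl, dotvDr, dotvZl, dotvZr).
rewrite (dotvC v u) uE vE; move: (normv u) (normv v) nu nv (dotv u v) => x y x0 y0 z.
by field; rewrite x0 y0.
Qed.

Lemma unitvE u a : unitv u 0 a = u 0 a / normv u.
Proof. by rewrite mxE mulrC. Qed.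

Lemma nbarE u v b : 0 < gram u v ->
  nbar v u 0 b = normv u * (v 0 b - dotv u v / dotv u u * u 0 b) / Num.sqrt (gram u v).
Proof.
move=> g0; have A0 := gram_gt0l g0; have C0 := gram_gt0r g0.
have g0' : 0 < gram v u by rewrite gramC.
rewrite /nbar unitvE normv_nvec// !mxE cos_angle//.
have nu : normv u != 0 by rewrite gt_eqF// sqrtr_gt0.
have nv : normv v != 0 by rewrite gt_eqF// sqrtr_gt0.
have ng : Num.sqrt (gram u v) != 0 by rewrite gt_eqF// sqrtr_gt0.
have uE : dotv u u = normv u ^+ 2 by rewrite sqr_sqrtr// ltW.
rewrite (dotvC v u) uE; move: (normv u) (normv v) (Num.sqrt _) nu nv ng (dotv u v) => x y s x0 y0 s0 z.
by field; rewrite x0 y0 s0.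
Qed.

Lemma outer_sub_add_entry (c : R) u v a b :
  (c *: (1%:M - outer u u + outer v v)) a b = c * ((a == b)%:R - u 0 a * u 0 b + v 0 a * v 0 b).
Proof. by rewrite !mxE !big_ord1 !mxE. Qed.

Lemma outer_add_entry (c d : R) u v u' v' a b :
  (c *: (d%:M + outer u u' + outer v v')) a b =
  c * (d * (a == b)%:R + u 0 a * u' 0 b + v 0 a * v' 0 b).
Proof. by rewrite !mxE !big_ord1 !mxE mulr_natr. Qed.

(** Rewriting the entries through the Gram entries and one square root removes all norms and angles,
    so that a computed derivative can be matched by [field]. *)
Lemma h1E u v a b : 0 < gram u v ->
  h1 u v a b = (2 * pi)^-1 * (Num.sqrt (gram u v) / dotv u u *
      ((a == b)%:R - u 0 a * u 0 b / dotv u u)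
    + (v 0 a - dotv u v / dotv u u * u 0 a) * (v 0 b - dotv u v / dotv u u * u 0 b)
      / Num.sqrt (gram u v)).
Proof.
move=> g0; have A0 := gram_gt0l g0; have C0 := gram_gt0r g0.
rewrite /h1 outer_sub_add_entry sin_angle// !nbarE// !unitvE.
have nu : normv u != 0 by rewrite gt_eqF// sqrtr_gt0.
have nv : normv v != 0 by rewrite gt_eqF// sqrtr_gt0.
have ng : Num.sqrt (gram u v) != 0 by rewrite gt_eqF// sqrtr_gt0.
have uE : dotv u u = normv u ^+ 2 by rewrite sqr_sqrtr// ltW.
have : pi != 0 :> R by rewrite gt_eqF ?pi_gt0.
rewrite uE; move: pi (normv u) (normv v) (Num.sqrt _) nu nv ng (dotv u v) (_ == _)%:R
  => P x y s x0 y0 s0 z e P0.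
by field; rewrite x0 y0 s0 P0.
Qed.

(** The order [h2 v u] is the one in which the block arises: the gradient in u is differentiated
    with respect to v. *)
Lemma h2E u v a b : 0 < gram u v ->
  h2 v u a b = (2 * pi)^-1 * ((pi - angle u v) * (a == b)%:R
    + (v 0 a - dotv u v / dotv u u * u 0 a) * u 0 b / Num.sqrt (gram u v)
    + (u 0 a - dotv u v / dotv v v * v 0 a) * v 0 b / Num.sqrt (gram u v)).
Proof.
move=> g0; have A0 := gram_gt0l g0; have C0 := gram_gt0r g0.
have g0' : 0 < gram v u by rewrite gramC.
rewrite /h2 outer_add_entry !nbarE// !unitvE (gramC v u) (dotvC v u) (angleC v u).
have nu : normv u != 0 by rewrite gt_eqF// sqrtr_gt0.
have nv : normv v != 0 by rewrite gt_eqF// sqrtr_gt0.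
have ng : Num.sqrt (gram u v) != 0 by rewrite gt_eqF// sqrtr_gt0.
have uE : dotv u u = normv u ^+ 2 by rewrite sqr_sqrtr// ltW.
have vE : dotv v v = normv v ^+ 2 by rewrite sqr_sqrtr// ltW.
have : pi != 0 :> R by rewrite gt_eqF ?pi_gt0.
rewrite uE vE; move: pi (angle u v) (normv u) (normv v) (Num.sqrt _) nu nv ng (dotv u v) (_ == _)%:R
  => P T x y s x0 y0 s0 z e P0.
by field; rewrite x0 y0 s0 P0.
Qed.

End DotProduct.

(** * First and second directional derivatives of the kernel *)

Section GradientAndHessian.
Context {R : realType}.
Implicit Types (A B C : R -> R) (x : R).

Lemma is_derive_sqrt_gram A B C x (A' B' C' : R) :
  is_derive x 1 A A' -> is_derive x 1 B B' -> is_derive x 1 C C' ->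
  0 < A x * C x - B x ^+ 2 ->
  is_derive x 1 (fun y => Num.sqrt (A y * C y - B y ^+ 2))
    ((A' * C x + A x * C' - 2 * B x * B') / (2 * Num.sqrt (A x * C x - B x ^+ 2))).
Proof.
move=> hA hB hC g0.
have hin := is_derive1D (is_derive1M hA hC) (is_derive1N (is_derive1X 1 hB)).
by apply: (is_derive_eq (is_derive1_chain hin (is_derive1_sqrt g0))); rewrite mulrC expr1.
Qed.

(** Since 1 - cos^2 = (A C - B^2) / (A C), the singular factor in the derivative of [acos] becomes
    the inverse square root of the Gram determinant. *)
Lemma is_derive_acos_gram A B C x (A' B' C' : R) :
  is_derive x 1 A A' -> is_derive x 1 B B' -> is_derive x 1 C C' ->
  0 < A x -> 0 < C x -> 0 < A x * C x - B x ^+ 2 ->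
  is_derive x 1 (fun y => acos (B y / (Num.sqrt (A y) * Num.sqrt (C y))))
    (- ((B' - B x * A' / (2 * A x) - B x * C' / (2 * C x)) / Num.sqrt (A x * C x - B x ^+ 2))).
Proof.
move=> hA hB hC A0 C0 g0.
have sA := is_derive1_chain hA (is_derive1_sqrt A0).
have sC := is_derive1_chain hC (is_derive1_sqrt C0).
have a0 : 0 < Num.sqrt (A x) by rewrite sqrtr_gt0.
have c0 : 0 < Num.sqrt (C x) by rewrite sqrtr_gt0.
have n0 : 0 < Num.sqrt (A x) * Num.sqrt (C x) by rewrite mulr_gt0.
have hq := is_derive1M hB (is_derive1V (is_derive1M sA sC) (lt0r_neq0 n0)).
have bnd : -1 < B x / (Num.sqrt (A x) * Num.sqrt (C x)) < 1.
  rewrite -ltr_norml -(@ltr_pXn2r _ 2)// ?nnegrE// expr1n real_normK ?num_real//.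
  rewrite exprMn exprVn exprMn !sqr_sqrtr ?ltW// ltr_pdivrMr ?mulr_gt0// mul1r.
  by rewrite -subr_gt0.
apply: (is_derive_eq (is_derive1_chain hq (is_derive1_acos bnd))).
have -> : 1 - (B x / (Num.sqrt (A x) * Num.sqrt (C x))) ^+ 2 =
    (A x * C x - B x ^+ 2) / (Num.sqrt (A x) * Num.sqrt (C x)) ^+ 2.
  have AE : A x = Num.sqrt (A x) ^+ 2 by rewrite sqr_sqrtr// ltW.
  have CE : C x = Num.sqrt (C x) ^+ 2 by rewrite sqr_sqrtr// ltW.
  have -> : A x * C x = (Num.sqrt (A x) * Num.sqrt (C x)) ^+ 2 by rewrite exprMn -AE -CE.
  move: (Num.sqrt (A x) * Num.sqrt (C x)) n0 => n n0.
  by field; rewrite gt_eqF.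
rewrite sqrtrM ?ltW// sqrtrV ?sqr_ge0// sqrtr_sqr gtr0_norm//.
have s0 : 0 < Num.sqrt (A x * C x - B x ^+ 2) by rewrite sqrtr_gt0.
move: (Num.sqrt (_ - _)) s0 => s s0.
have AE : A x = Num.sqrt (A x) ^+ 2 by rewrite sqr_sqrtr// ltW.
have CE : C x = Num.sqrt (C x) ^+ 2 by rewrite sqr_sqrtr// ltW.
rewrite [in RHS]AE [in RHS]CE.
move: (Num.sqrt (A x)) (Num.sqrt (C x)) a0 c0 => p q p0 q0.
by field; rewrite !gt_eqF.
Qed.

Variable k : nat.
Implicit Types (u v du dv : 'rV[R]_k).

Lemma is_derive_dotv u v du dv :
  is_derive (0 : R) 1 (fun t : R => dotv (t *: du + u) (t *: dv + v)) (dotv du v + dotv u dv).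
Proof.
rewrite (_ : (fun t => _) =
    (fun t : R => t * (t * dotv du dv) + t * (dotv du v + dotv u dv) + dotv u v)); last first.
  by apply/funext => t; rewrite !(dotvDl, dotvDr, dotvZl, dotvZr); ring.
apply: (is_derive_eq (is_derive1D (is_derive1D (is_derive1M (is_derive1I 0) (is_derive1M (is_derive1I 0) (is_derive1C _ 0))) (is_derive1M (is_derive1I 0) (is_derive1C _ 0))) (is_derive1C _ 0))).
by ring.
Qed.

Lemma is_derive_coord u du b :
  is_derive (0 : R) 1 (fun t : R => (t *: du + u) 0 b) (du 0 b).
Proof.
rewrite (_ : (fun t => _) = (fun t : R => t * du 0 b + u 0 b)).
  by apply: (is_derive_eq (is_derive1D (is_derive1M (is_derive1I 0) (is_derive1C _ 0)) (is_derive1C _ 0))); ring.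
by apply/funext => t; rewrite !mxE.
Qed.

Lemma is_derive_gram u v du dv : 0 < gram u v ->
  is_derive (0 : R) 1 (fun t : R => Num.sqrt (gram (t *: du + u) (t *: dv + v)))
   ((dotv u du * dotv v v + dotv u u * dotv v dv - dotv u v * (dotv du v + dotv u dv))
     / Num.sqrt (gram u v)).
Proof.
move=> g0.
have := is_derive_sqrt_gram (is_derive_dotv u u du du) (is_derive_dotv u v du dv)
  (is_derive_dotv v v dv dv).
rewrite !scale0r !add0r => /(_ g0) h; apply: (is_derive_eq h).
rewrite (dotvC du u) (dotvC dv v) -/(gram u v).
have s0 : 0 < Num.sqrt (gram u v) by rewrite sqrtr_gt0.
by field; rewrite gt_eqF.
Qed.

Lemma is_derive_angle u v du dv : 0 < gram u v ->
  is_derive (0 : R) 1 (fun t : R => angle (t *: du + u) (t *: dv + v))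
   (- ((dotv du v + dotv u dv - dotv u v * dotv u du / dotv u u - dotv u v * dotv v dv / dotv v v)
     / Num.sqrt (gram u v))).
Proof.
move=> g0; have A0 := gram_gt0l g0; have C0 := gram_gt0r g0.
have := is_derive_acos_gram (is_derive_dotv u u du du) (is_derive_dotv u v du dv)
  (is_derive_dotv v v dv dv).
rewrite !scale0r !add0r => /(_ A0 C0 g0) h; apply: (is_derive_eq h).
rewrite (dotvC du u) (dotvC dv v) -/(gram u v).
have s0 : 0 < Num.sqrt (gram u v) by rewrite sqrtr_gt0.
by field; rewrite !gt_eqF.
Qed.

Definition relu_kernelv u v : R := relu_kernel (dotv u u) (dotv u v) (dotv v v).

(** Coordinate b of the gradient of the kernel in u: by the chain rule, 2 u_b times its partial
    derivative in A = u.u, plus v_b times that in B = u.v. *)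
Definition grad b u v : R :=
  (2 * pi)^-1 * (Num.sqrt (gram u v) / dotv u u * u 0 b + (pi - angle u v) * v 0 b).

Lemma is_derive_relu_kernelv u v b : 0 < gram u v ->
  is_derive (0 : R) 1 (fun t : R => relu_kernelv (t *: delta_mx 0 b + u) v) (grad b u v).
Proof.
move=> g0; have A0 := gram_gt0l g0; have C0 := gram_gt0r g0.
have pin0 : pi != 0 :> R by rewrite gt_eqF ?pi_gt0.
have A1 := lt0r_neq0 A0; have C1 := lt0r_neq0 C0.
have hg := is_derive_gram (delta_mx 0 b) 0 g0.
have ha := is_derive_angle (delta_mx 0 b) 0 g0.
have hd := is_derive_dotv u v (delta_mx 0 b) 0.
have h := is_derive1M (is_derive1C (2 * pi)^-1 0) (is_derive1D hg (is_derive1M (is_derive1D (is_derive1C pi 0) (is_derive1N ha)) hd)).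
rewrite (_ : (fun t => _) = (fun t : R => (2 * pi)^-1 *
  (Num.sqrt (gram (t *: delta_mx 0 b + u) (t *: 0 + v)) +
   (pi - angle (t *: delta_mx 0 b + u) (t *: 0 + v)) *
    dotv (t *: delta_mx 0 b + u) (t *: 0 + v)))); last first.
  by apply/funext => t; rewrite scaler0 add0r.
apply: (is_derive_eq h).
rewrite !scale0r !add0r !dotv0r dotv_deltal dotv_deltar /grad /gram.
have : 0 < Num.sqrt (gram u v) by rewrite sqrtr_gt0.
have sE : Num.sqrt (gram u v) ^+ 2 = gram u v by rewrite sqr_sqrtr// ltW.
move: sE; rewrite /gram; move: (Num.sqrt _) => s sE s0.
(* Eliminating v.v builds the relation s^2 = A C - B^2 into the goal; with it the term B times the
   derivative of the angle cancels, and [field] can conclude. *)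
have CE : dotv v v = (s ^+ 2 + dotv u v ^+ 2) / dotv u u.
  by rewrite sE; field; rewrite gt_eqF.
rewrite !(mulr0, mul0r, addr0, subr0, oppr0, add0r) CE; move: pi pin0 (angle u v) => P P0 T.
by field; rewrite P0 A1 (lt0r_neq0 s0).
Qed.

Lemma is_derive_grad_diag u v a b : 0 < gram u v ->
  is_derive (0 : R) 1 (fun t : R => grad b (t *: delta_mx 0 a + u) v) (h1 u v a b).
Proof.
move=> g0; have A0 := gram_gt0l g0; have C0 := gram_gt0r g0.
have pin0 : pi != 0 :> R by rewrite gt_eqF ?pi_gt0.
have A1 := lt0r_neq0 A0; have C1 := lt0r_neq0 C0.
have hg := is_derive_gram (delta_mx 0 a) 0 g0.
have ha := is_derive_angle (delta_mx 0 a) 0 g0.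
have hd := is_derive_dotv u u (delta_mx 0 a) (delta_mx 0 a).
have hb := is_derive_coord u (delta_mx 0 a) b.
have d0 : dotv (0 *: delta_mx 0 a + u) (0 *: delta_mx 0 a + u) != 0.
  by rewrite scale0r add0r gt_eqF.
have h := is_derive1M (is_derive1C (2 * pi)^-1 0) (is_derive1D (is_derive1M (is_derive1M hg (is_derive1V hd d0)) hb)
  (is_derive1M (is_derive1D (is_derive1C pi 0) (is_derive1N ha)) (is_derive1C (v 0 b) 0))).
rewrite (_ : (fun t => _) = (fun t : R => (2 * pi)^-1 *
  (Num.sqrt (gram (t *: delta_mx 0 a + u) (t *: 0 + v)) /
   dotv (t *: delta_mx 0 a + u) (t *: delta_mx 0 a + u) * (t *: delta_mx 0 a + u) 0 b +
   (pi - angle (t *: delta_mx 0 a + u) (t *: 0 + v)) * v 0 b))); last first.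
  by apply/funext => t; rewrite scaler0 add0r.
apply: (is_derive_eq h).
rewrite h1E// !scale0r !add0r !dotv0r !dotv_deltal !dotv_deltar /gram mxE eqxx /= eq_sym.
have : 0 < Num.sqrt (gram u v) by rewrite sqrtr_gt0.
have sE : Num.sqrt (gram u v) ^+ 2 = gram u v by rewrite sqr_sqrtr// ltW.
move: sE; rewrite /gram; move: (Num.sqrt _) => s sE s0.
have CE : dotv v v = (s ^+ 2 + dotv u v ^+ 2) / dotv u u.
  by rewrite sE; field; rewrite gt_eqF.
rewrite !(mulr0, mul0r, addr0, subr0, oppr0, add0r) CE; move: pi pin0 (angle u v) (_ == _)%:R => P P0 T e.
by field; rewrite P0 A1 (lt0r_neq0 s0).
Qed.

Lemma is_derive_grad_offdiag u v a b : 0 < gram u v ->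
  is_derive (0 : R) 1 (fun t : R => grad b u (t *: delta_mx 0 a + v)) (h2 v u a b).
Proof.
move=> g0; have A0 := gram_gt0l g0; have C0 := gram_gt0r g0.
have pin0 : pi != 0 :> R by rewrite gt_eqF ?pi_gt0.
have A1 := lt0r_neq0 A0; have C1 := lt0r_neq0 C0.
have hg := is_derive_gram 0 (delta_mx 0 a) g0.
have ha := is_derive_angle 0 (delta_mx 0 a) g0.
have hb := is_derive_coord v (delta_mx 0 a) b.
have h := is_derive1M (is_derive1C (2 * pi)^-1 0) (is_derive1D (is_derive1M (is_derive1M hg (is_derive1C (dotv u u)^-1 0)) (is_derive1C (u 0 b) 0))
  (is_derive1M (is_derive1D (is_derive1C pi 0) (is_derive1N ha)) hb)).
rewrite (_ : (fun t => _) = (fun t : R => (2 * pi)^-1 *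
  (Num.sqrt (gram (t *: 0 + u) (t *: delta_mx 0 a + v)) / dotv u u * u 0 b +
   (pi - angle (t *: 0 + u) (t *: delta_mx 0 a + v)) * (t *: delta_mx 0 a + v) 0 b))); last first.
  by apply/funext => t; rewrite scaler0 add0r.
apply: (is_derive_eq h).
rewrite h2E// !scale0r !add0r !dotv0r !dotv0l !dotv_deltar mxE eqxx /= eq_sym.
have s0 : 0 < Num.sqrt (gram u v) by rewrite sqrtr_gt0.
move: pi pin0 (angle u v) (_ == _)%:R (Num.sqrt _) s0 => P P0 T e s s0.
by field; rewrite P0 A1 C1 (lt0r_neq0 s0).
Qed.

End GradientAndHessian.

(** * Continuity of the Gram determinant *)

Lemma continuous_dotv (R : realType) (T : topologicalType) (k : nat) (f g : T -> 'rV[R]_k) :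
  (forall a, continuous (fun x => f x 0 a)) -> (forall a, continuous (fun x => g x 0 a)) ->
  continuous (fun x => dotv (f x) (g x)).
Proof.
move=> cf cg x.
rewrite (_ : (fun y => _) = \sum_(a < k) (fun y => f y 0 a * g y 0 a)); last first.
  by apply/funext => y; rewrite /dotv fct_sumE.
elim/big_rec: _ => [|a h _ ch]; first exact: cst_continuous.
by apply: continuousD => //; apply: continuousM; [exact: cf|exact: cg].
Qed.

Lemma continuous_gram (R : realType) (T : topologicalType) (k : nat) (f g : T -> 'rV[R]_k) :
  (forall a, continuous (fun x => f x 0 a)) -> (forall a, continuous (fun x => g x 0 a)) ->
  continuous (fun x => gram (f x) (g x)).
Proof.
move=> cf cg x; rewrite /gram; under eq_fun do rewrite expr2.
apply: (@continuousB _ _ _ (fun y => dotv (f y) (f y) * dotv (g y) (g y))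
  (fun y => dotv (f y) (g y) * dotv (f y) (g y))).
  by apply: continuousM; exact: continuous_dotv.
by apply: continuousM; exact: continuous_dotv.
Qed.

Lemma near_gram_gt0 (R : realType) (T : topologicalType) (k : nat) (f g : T -> 'rV[R]_k) x :
  (forall a, continuous (fun x => f x 0 a)) -> (forall a, continuous (fun x => g x 0 a)) ->
  0 < gram (f x) (g x) -> \forall y \near x, 0 < gram (f y) (g y).
Proof.
move=> cf cg; have c := @continuous_gram R T k f g cf cg x.
by move=> h; have H := cvgr_gt _ c; apply: H h.
Qed.

(** * Derivatives of the objective in the entries of the weight matrix *)

Section Objective.
Context {R : realType} {n k : nat}.
Variable V : 'M[R]_(k, k).
Implicit Types (U W : 'M[R]_(n, k)) (i j : 'I_n) (a b : 'I_k) (t : R).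

Lemma row_delta_eq j b t U :
  row j (t *: delta_mx j b + U) = t *: delta_mx 0 b + row j U.
Proof. by apply/rowP => l; rewrite !mxE !eqxx. Qed.

Lemma row_delta_neq i j b t U : i != j -> row i (t *: delta_mx j b + U) = row i U.
Proof.
by move=> ij; apply/rowP => l; rewrite !mxE (negbTE ij) /= mulr0 add0r.
Qed.

(** Reduces directional derivatives on matrices to the one-variable calculus above. *)
Lemma is_derive_line (f : 'M[R]_(n, k) -> R) U (v : 'M[R]_(n, k)) (d : R) :
  is_derive (0 : R) 1 (fun t : R => f (t *: v + U)) d -> is_derive U v f d.
Proof.
move=> [hd hv]; split; first exact/derivable1P.
rewrite -hv /derive; set g1 := fun h => h^-1 *: _; set g2 := fun h => h^-1 *: _.
suff -> : g1 = g2 by []; apply/funext => t; rewrite /g1 /g2 /=.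
by rewrite addr0 scale0r add0r [_%:A]mulr1.
Qed.

(** The terms of the objective free of row j, constant along every line that moves only that row. *)
Definition rest j U : R :=
  (\sum_(i | i != j) \sum_(l | l != j) corr (row i U) (row l U)) / 2
  + (\sum_(i < k) \sum_(l < k) corr (row i V) (row l V)) / 2
  - \sum_(i | i != j) \sum_(l < k) corr (row i U) (row l V).

Lemma rest_delta j b t U : rest j (t *: delta_mx j b + U) = rest j U.
Proof.
rewrite /rest; congr (_ / 2 + _ - _).
  apply: eq_bigr => i ij; apply: eq_bigr => l lj; by rewrite !row_delta_neq.
by apply: eq_bigr => i ij; apply: eq_bigr => l _; rewrite row_delta_neq.
Qed.

(** By symmetry each pair (j, l) with l different from j occurs twice in the double sum, which
    absorbs the factor 1 / 2; the diagonal term keeps it. *)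
Lemma Fobj_split j U : Fobj V U = rest j U + (corr (row j U) (row j U) / 2
  + \sum_(l | l != j) corr (row j U) (row l U) - \sum_(l < k) corr (row j U) (row l V)).
Proof.
rewrite FobjE /rest (bigD1 j)//= (bigD1 j (P := predT) (F := fun l => corr (row j U) (row l U)))//=.
rewrite [X in _ - X](bigD1 j)//=.
have -> : \sum_(i < n | i != j) \sum_(l < n) corr (row i U) (row l U) =
    \sum_(l | l != j) corr (row j U) (row l U) +
    \sum_(i | i != j) \sum_(l | l != j) corr (row i U) (row l U).
  rewrite -big_split; apply: eq_bigr => i ij /=.
  by rewrite (bigD1 j)//= corr_sym.
by field.
Qed.

(** An open condition on U under which the closed form holds for every pair whose correlation varies
    with U, apart from a row paired with itself. *)
Definition nondegenerate U :=
  (forall i l, i != l -> 0 < gram (row i U) (row l U)) /\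
  (forall i (l : 'I_k), 0 < gram (row i U) (row l V)).

Lemma continuous_row i a : continuous (fun U => row i U 0 a).
Proof.
by under eq_fun do rewrite mxE; exact: coord_continuous.
Qed.

Lemma near_nondegenerate W : nondegenerate W -> \forall U \near W, nondegenerate U.
Proof.
move=> [g1 g2].
have N1 : \forall U \near W, forall i l, i != l -> 0 < gram (row i U) (row l U).
  apply: (@filter_forall _ _ (fun i U => forall l, i != l -> 0 < gram (row i U) (row l U))
    (nbhs W) _) => i.
  apply: (@filter_forall _ _ (fun l U => i != l -> 0 < gram (row i U) (row l U))
    (nbhs W) _) => l.
  have [il|il] := eqVneq i l; first exact: nearW.
  have h := near_gram_gt0 (@continuous_row i) (@continuous_row l) (g1 i l il).
  exact: (filterS (fun U gU _ => gU) h).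
have N2 : \forall U \near W, forall i (l : 'I_k), 0 < gram (row i U) (row l V).
  apply: (@filter_forall _ _ (fun i U => forall l : 'I_k, 0 < gram (row i U) (row l V))
    (nbhs W) _) => i.
  apply: (@filter_forall _ _ (fun l U => 0 < gram (row i U) (row l V)) (nbhs W) _) => l.
  exact: (near_gram_gt0 (@continuous_row i) (fun a => @cst_continuous _ _ (row l V 0 a)) (g2 i l)).
by near=> U; split; [near: U|near: U].
Unshelve. all: by end_near. Qed.

Definition Fgrad j b U : R := U j b / 2 + \sum_(l | l != j) grad b (row j U) (row l U)
  - \sum_(l < k) grad b (row j U) (row l V).

(** Nondegeneracy is required on a neighbourhood because the closed form must agree with the
    objective around U before it can be differentiated in its place. *)
Lemma is_derive_Fobj j b U : (\forall U' \near U, nondegenerate U') ->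
  is_derive U (delta_mx j b) (Fobj V) (Fgrad j b U).
Proof.
move=> Hn; have [g1 g2] := nbhs_singleton Hn.
have neq_sym l : l != j -> j != l by rewrite eq_sym.
pose Phi U : R := rest j U + (dotv (row j U) (row j U) / 2 / 2
  + \sum_(l | l != j) relu_kernelv (row j U) (row l U)
  - \sum_(l < k) relu_kernelv (row j U) (row l V)).
apply: (@near_eq_is_derive _ _ _ Phi).
  apply: filterS Hn => U' [h1 h2]; rewrite (Fobj_split j) corr_diag; congr (_ + (_ + _ - _)).
    by apply: eq_bigr => l lj; rewrite corr_relu_kernel// h1// eq_sym.
  by apply: eq_bigr => l _; rewrite corr_relu_kernel.
apply: is_derive_line; rewrite /Phi.
under eq_fun => t.
  rewrite rest_delta row_delta_eq.
  under eq_bigr => l lj do rewrite row_delta_neq//.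
  over.
have hd := is_derive_dotv (row j U) (row j U) (delta_mx 0 b) (delta_mx 0 b).
have hs1 := @is_derive1_sum R n _ _ (fun l => l != j) 0
  (fun l lj => is_derive_relu_kernelv b (g1 j l (neq_sym l lj))).
have hs2 := @is_derive1_sum R k _ _ predT 0
  (fun l _ => is_derive_relu_kernelv b (g2 j l)).
have hd2 := is_derive1M (is_derive1M hd (is_derive1C 2^-1 0)) (is_derive1C 2^-1 0).
apply: (is_derive_eq (is_derive1D (is_derive1C (rest j U) 0)
  (is_derive1D (is_derive1D hd2 hs1) (is_derive1N hs2)))).
rewrite add0r /Fgrad; congr (_ + _ - _).
by rewrite dotv_deltal dotv_deltar mxE; field.
Qed.

Lemma is_derive_Fgrad_diag j a b W : nondegenerate W ->
  is_derive W (delta_mx j a) (Fgrad j b)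
    (((2^-1)%:M + \sum_(l < n | l != j) h1 (row j W) (row l W)
      - \sum_(l < k) h1 (row j W) (row l V)) a b).
Proof.
move=> [g1 g2]; have neq_sym l : l != j -> j != l by rewrite eq_sym.
apply: is_derive_line; rewrite /Fgrad.
under eq_fun => t.
  rewrite row_delta_eq.
  under eq_bigr => l lj do rewrite row_delta_neq//.
  over.
have hs1 := @is_derive1_sum R n _ _ (fun l => l != j) 0
  (fun l lj => is_derive_grad_diag a b (g1 j l (neq_sym l lj))).
have hs2 := @is_derive1_sum R k _ _ predT 0
  (fun l _ => is_derive_grad_diag a b (g2 j l)).
have hc : is_derive (0 : R) 1 (fun t : R => (t *: delta_mx j a + W) j b) ((a == b)%:R).
  rewrite (_ : (fun t => _) = (fun t : R => t * (a == b)%:R + W j b)).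
    by apply: (is_derive_eq (is_derive1D (is_derive1M (is_derive1I 0) (is_derive1C _ 0)) (is_derive1C _ 0))); ring.
  by apply/funext => t; rewrite !mxE eqxx /= eq_sym.
apply: (is_derive_eq (is_derive1D (is_derive1D (is_derive1M hc (is_derive1C 2^-1 0)) hs1)
  (is_derive1N hs2))).
rewrite !mxE !summxE mulr0 addr0; congr (_ + _ - _).
by rewrite mulr_natl.
Qed.

Lemma is_derive_Fgrad_offdiag i j a b W : i != j -> nondegenerate W ->
  is_derive W (delta_mx i a) (Fgrad j b) (h2 (row i W) (row j W) a b).
Proof.
move=> ij [g1 g2]; have ji : j != i by rewrite eq_sym.
apply: is_derive_line; rewrite /Fgrad.
under eq_fun => t do rewrite row_delta_neq//.
(* Moving row i affects only the term l = i of this sum, through the second argument of [grad]. *)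
have hs1 : is_derive (0 : R) 1
    (fun t : R => \sum_(l | l != j) grad b (row j W) (row l (t *: delta_mx i a + W)))
    (\sum_(l | l != j) if l == i then h2 (row i W) (row j W) a b else 0).
  apply: is_derive1_sum => l lj; have [->|li] := eqVneq l i.
    under eq_fun do rewrite row_delta_eq; exact: is_derive_grad_offdiag (g1 j i ji).
  by under eq_fun do rewrite row_delta_neq//; exact: is_derive1C.
have hc : is_derive (0 : R) 1 (fun t : R => (t *: delta_mx i a + W) j b) 0.
  rewrite (_ : (fun t => _) = (fun t : R => W j b)); first exact: is_derive1C.
  by apply/funext => t; rewrite !mxE (negbTE ji) /= mulr0 add0r.
apply: (is_derive_eq (is_derive1D (is_derive1D (is_derive1M hc (is_derive1C 2^-1 0)) hs1)
  (is_derive1N (is_derive1C _ 0)))).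
rewrite (bigD1 i)//= eqxx big1 => [|l /andP[_ /negbTE ->]//].
by ring.
Qed.

End Objective.

Theorem theorem5 (R : realType) (n k : nat) (V : 'M[R]_(k, k)) (W : 'M[R]_(n, k)) :
  (forall i : 'I_n, row i W != 0) ->
  (forall j : 'I_k, row j V != 0) ->
  (forall i j : 'I_n, i != j ->
     0 < angle (row i W) (row j W) < pi) ->
  (forall (i : 'I_n) (j : 'I_k),
     0 < angle (row i W) (row j V) < pi) ->
  forall (i j : 'I_n) (a b : 'I_k),
    (\forall U \near W, derivable (Fobj V) U (delta_mx j b)) /\
    derivable (fun U => 'D_(delta_mx j b) (Fobj V) U) W (delta_mx i a) /\
    'D_(delta_mx i a) (fun U => 'D_(delta_mx j b) (Fobj V) U) W =
      (if i == j then
         (2^-1)%:M + \sum_(j' < n | j' != i) h1 (row i W) (row j' W)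
                   - \sum_(j' < k) h1 (row i W) (row j' V)
       else h2 (row i W) (row j W)) a b.
Proof.
move=> W0 V0 WW WV i j a b.
have nW : nondegenerate V W.
  by split=> [i' l il|i' l]; apply: angle_gram_gt0 => //; exact: WW.
(* Every point near [W] has in turn a nondegenerate neighbourhood, so the first-derivative formula
   is valid at all of these points. *)
have nn := near_join (near_nondegenerate nW).
split.
  by apply: filterS nn => U hU; have [] := is_derive_Fobj j b hU.
(* Agreement near [W], not just at [W], is what transfers the derivative of [Fgrad] to the second
   derivative of the objective. *)
have eqD : \near W, Fgrad V j b W = 'D_(delta_mx j b) (Fobj V) W.
  by apply: filterS nn => U hU; have [_ ->] := is_derive_Fobj j b hU.
have [->|ij] := eqVneq i j.
  by have [] := near_eq_is_derive eqD (is_derive_Fgrad_diag j a b nW).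
by have [] := near_eq_is_derive eqD (is_derive_Fgrad_offdiag a b ij nW).
Qed.
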